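(* Let $\mathcal{C}$ be the circle $\{x\in\mathbb{C}_p : |x-a|_p=R\}$, $R>0$. Let $\mathcal{D} = D^{+}(a,R)\setminus\bigcup_{i = 1}^{M}D^{-}(x_{i},\rho_{i})$, with $0<\rho_{i} < R$ for all $i$. Let $\mathcal{C}_{i}$ be the circle with center $x_{i}$ and radius $r_{i}$, where $\rho_{i} \leq r_{i} < R$. Let $b$ be a point on $\mathcal{C}$ with $|b - x_{i}|_{p} = R$ for all $i$, and let $b_{i}$ be a point on $\mathcal{C}_{i}$ for each $i$. Suppose that the discs $D^{+}(x_{i},r_{i})$ are mutually disjoint. Let $\alpha \in \mathbb{Z}_{\geq 0}$. Then, if $f$ is a Krasner analytic function on $\mathcal{D}$, $$\int_{\mathcal{A}(a,b),\Phi_{\alpha}}f(x)\,dx = \sum_{i = 1}^{M}\frac{1}{1 - \omega\left( \frac{a - x_{i}}{a - b}\right)^{p^{\alpha}}}\int_{\mathcal{A}(x_{i},b_{i}),\Phi_{\alpha}}f(x)\,dx ,$$ all the integrals existing. (In particular the constant coefficients depend only on $\alpha$, the arc $\mathcal{A}(a,b)$, $\mathcal{D}$ and the choice of boundary circle $\mathcal{C}$.)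
   Context: $p$ is an odd prime; $\mathbb{C}_p$ is the completion of an algebraic closure of $\mathbb{Q}_p$, with $|p|_p=1/p$. $D^+(c,r)$ and $D^-(c,r)$ are the closed and open discs with center $c$ and radius $r$. Arc: for $a\ne b$ in $\mathbb{C}_p$ with $R=|a-b|_p$, the arc $\mathcal{A}(a,b)$ is the open disc $\{x : |x-b|_p<R\}$. Path sequence: a function $\varphi$ defined for all integers $k\ge k_0$ (some $k_0\in\mathbb{Z}^+$), with values in $\mathbb{Z}^+$ and strictly increasing. For $f:\mathcal{A}(a,b)\to\mathbb{C}_p$ put $A_{f,\varphi}(k)=p^{-\varphi(k)}\sum_{\zeta}(x-a)f(x)$, where $x=a+(b-a)\zeta$ and $\zeta$ runs through the $p^{\varphi(k)}$-th roots of unity. A non-empty family $\Phi$ of path sequences is interlocked if for all $\varphi_1,\varphi_2\in\Phi$ there are $\varphi_3\in\Phi$ and $k_0$ such that $\varphi_3(k)$, $k\ge k_0$, is a subsequence of both $\varphi_1$ and $\varphi_2$. For interlocked $\Phi$, $\int_{\mathcal{A}(a,b),\Phi}f(x)\,dx=L$ means: for every $\varepsilon>0$ there are $\varphi_\varepsilon\in\Phi$ and $K_\varepsilon$ with $|A_{f,\varphi_\varepsilon}(k)-L|_p<\varepsilon$ for all $k>K_\varepsilon$ (such $L$ is unique if it exists). For $\alpha\in\mathbb{Z}$, $\Phi_\alpha$ is the interlocked family $\{\varphi : \varphi(k)=\alpha+\lambda k,\ \lambda=1,2,\dots\}$. $\omega$ is the Teichmüller character: for $|x|_p=1$, $\omega(x)$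 is the unique root of unity of order prime to $p$ with $|x-\omega(x)|_p<1$; $\omega(x)=0$ if $|x|_p<1$. A function on $\mathcal{D}$ (a closed disc with finitely many open discs removed) is Krasner analytic if it is the uniform limit on $\mathcal{D}$ of rational functions whose poles are outside $\mathcal{D}$. *)

(* Defs.v *)
From HB Require Import structures.
From mathcomp Require Import all_boot all_order all_algebra.
From mathcomp Require Import all_classical all_reals.
From mathcomp Require Import zify.

Set Implicit Arguments.
Unset Strict Implicit.
Unset Printing Implicit Defensive.

Import Order.TTheory GRing.Theory Num.Theory.
Local Open Scope classical_set_scope.
Local Open Scope ring_scope.

Definition ultrametric_abs (R : realType) (F : fieldType) (v : F -> R) : Prop :=
  [/\ forall x, 0 <= v x,
      forall x, v x = 0 <-> x = 0,
      forall x y, v (x * y) = v x * v y &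
      forall x y, v (x + y) <= Num.max (v x) (v y)].

Definition padic_abs (R : realType) (p : nat) (q : rat) : R :=
  if q == 0 then 0
  else p%:R ^+ logn p `|denq q|%N / p%:R ^+ logn p `|numq q|%N.

Definition complete_abs (R : realType) (F : fieldType) (v : F -> R) : Prop :=
  forall u : nat -> F,
    (forall e : R, 0 < e ->
       exists N, forall m n, (N <= m)%N -> (N <= n)%N -> v (u m - u n) < e) ->
    exists l : F, forall e : R, 0 < e ->
       exists N, forall n, (N <= n)%N -> v (u n - l) < e.

Definition is_completion (R : realType) (F K : fieldType)
    (vF : F -> R) (vK : K -> R) (i : {rmorphism F -> K}) : Prop :=
  [/\ forall x, vK (i x) = vF x,
      forall (y : K) (e : R), 0 < e -> exists x : F, vK (y - i x) < e &
      complete_abs vK].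

(* The tower Q -> Q_p -> algebraic closure of Q_p -> C_p.  Each step is unique
   up to isometric isomorphism, so quantifying over [Cp_tower R p] amounts to
   speaking of C_p itself. *)
Record Cp_tower (R : realType) (p : nat) := CpTower {
  Qp : fieldType;
  Qp_abs : Qp -> R;
  Qp_absP : ultrametric_abs Qp_abs;
  Qp_of_rat : {rmorphism rat -> Qp};
  Qp_completion : is_completion (@padic_abs R p) Qp_abs Qp_of_rat;
  Qpbar : closedFieldType;
  Qpbar_abs : Qpbar -> R;
  Qpbar_absP : ultrametric_abs Qpbar_abs;
  Qpbar_of_Qp : {rmorphism Qp -> Qpbar};
  Qpbar_algebraic : forall x : Qpbar, algebraicOver Qpbar_of_Qp x;
  Qpbar_isometry : forall x : Qp, Qpbar_abs (Qpbar_of_Qp x) = Qp_abs x;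
  Cp :> fieldType;
  Cp_abs : Cp -> R;
  Cp_absP : ultrametric_abs Cp_abs;
  Cp_of_Qpbar : {rmorphism Qpbar -> Cp};
  Cp_completion : is_completion Qpbar_abs Cp_abs Cp_of_Qpbar
}.

Record path_seq := PathSeq {
  ps_start : nat;
  ps_fun :> nat -> nat;  (* only the values at k >= ps_start are meaningful *)
  ps_start_gt0 : (0 < ps_start)%N;
  ps_gt0 : forall k, (ps_start <= k)%N -> (0 < ps_fun k)%N;
  ps_incr : forall k l, (ps_start <= k)%N -> (k < l)%N ->
    (ps_fun k < ps_fun l)%N
}.

Definition tail_subseq (phi3 : path_seq) (k0 : nat) (phi : path_seq) : Prop :=
  exists m : nat -> nat,
    (forall k l, (k0 <= k)%N -> (k < l)%N -> (m k < m l)%N) /\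
    (forall k, (k0 <= k)%N -> (ps_start phi <= m k)%N /\ phi3 k = phi (m k)).

Definition interlocked (Phi : set path_seq) : Prop :=
  Phi !=set0 /\
  forall phi1 phi2, Phi phi1 -> Phi phi2 ->
    exists phi3, Phi phi3 /\
      exists k0, [/\ (ps_start phi3 <= k0)%N,
                     tail_subseq phi3 k0 phi1 & tail_subseq phi3 k0 phi2].

Record interlocked_family := InterlockedFamily {
  if_set : set path_seq;
  if_interlocked : interlocked if_set
}.

(* The starting index is left free. *)
Definition Phi_set (alpha : int) : set path_seq :=
  [set phi : path_seq | exists lambda : nat, (0 < lambda)%N /\
     forall k : nat, (ps_start phi <= k)%N ->
       (phi k)%:Z = alpha + (lambda * k)%N%:Z].

Lemma Phi_path_exists (alpha : int) (lambda s : nat) : (0 < lambda)%N ->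
  exists phi : path_seq, (s <= ps_start phi)%N /\
    forall k : nat, (ps_start phi <= k)%N ->
      (phi k)%:Z = alpha + (lambda * k)%N%:Z.
Proof.
move=> l0; pose s' := (`|alpha| + s).+1.
pose v (k : nat) : nat := absz (alpha + (lambda * k)%N%:Z).
have val k : (s' <= k)%N ->
    (v k)%:Z = alpha + (lambda * k)%N%:Z.
  by move=> sk; have := leq_pmull k l0; rewrite /v /s' in sk *; lia.
have pos k : (s' <= k)%N -> (0 < v k)%N.
  by move=> sk; have := leq_pmull k l0; rewrite /v /s' in sk *; lia.
have incr k l : (s' <= k)%N -> (k < l)%N ->
    (v k < v l)%N.
  move=> sk kl; have lkl : (lambda * k < lambda * l)%N by rewrite ltn_pmul2l.
  have := val k sk; have := val l (leq_trans sk (ltnW kl)); lia.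
exists (@PathSeq s' _ (ltn0Sn _) pos incr); split; first by rewrite /s' /=; lia.
exact: val.
Qed.

Lemma Phi_interlocked (alpha : int) : interlocked (Phi_set alpha).
Proof.
split; first by have [phi [_ H]] := @Phi_path_exists alpha 1 0 isT; exists phi, 1%N.
move=> phi1 phi2 [l1 [l10 H1]] [l2 [l20 H2]].
have l0 : (0 < l1 * l2)%N by rewrite muln_gt0 l10.
have [phi3 [s3 H3]] :=
  Phi_path_exists alpha (ps_start phi1 + ps_start phi2) l0.
exists phi3; split; first by exists (l1 * l2)%N.
exists (ps_start phi3); split=> //.
- exists (fun k => (l2 * k)%N); split=> [k l _ kl|k hk].
    by rewrite ltn_pmul2l.
  have h : (ps_start phi1 <= l2 * k)%N by have := leq_pmull k l20; lia.
  by split=> //; have := H3 _ hk; rewrite -mulnA -(H1 _ h) => -[].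
- exists (fun k => (l1 * k)%N); split=> [k l _ kl|k hk].
    by rewrite ltn_pmul2l.
  have h : (ps_start phi2 <= l1 * k)%N by have := leq_pmull k l10; lia.
  by split=> //; have := H3 _ hk; rewrite (mulnC l1) -mulnA -(H2 _ h) => -[].
Qed.

Definition Phi_ (alpha : int) : interlocked_family :=
  InterlockedFamily (Phi_interlocked alpha).

Section Cp.
Variables (R : realType) (p : nat) (C : Cp_tower R p).

Local Notation abs := (@Cp_abs R p C).

Definition closed_disc (c : C) (r : R) : set C := [set x | abs (x - c) <= r].
Definition open_disc (c : C) (r : R) : set C := [set x | abs (x - c) < r].
Definition circle (c : C) (r : R) : set C := [set x | abs (x - c) = r].

Definition arc (a b : C) : set C := open_disc b (abs (a - b)).

Definition arc_node (a b z : C) : C := a + (b - a) * z.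

Definition arc_mean (a b : C) (f : C -> C) (n : nat) : C :=
  (p%:R ^+ n)^-1 *
  \sum_(z \in [set z : C | (p ^ n)%N.-unity_root z])
     (arc_node a b z - a) * f (arc_node a b z).

(* [f] is a total function, but only its values on [arc a b], where the nodes
   lie, are used (see [arc_node_arc]). *)
Definition is_arc_integral (a b : C) (Phi : interlocked_family)
    (f : C -> C) (L : C) : Prop :=
  forall e : R, 0 < e ->
    exists phi : path_seq, if_set Phi phi /\
      exists K : nat, forall k : nat, (ps_start phi <= k)%N -> (K < k)%N ->
        abs (arc_mean a b f (phi k) - L) < e.

Definition teichmuller (x : C) : C :=
  if abs x == 1 then
    xget 0 [set z : C | (exists m, coprime m p /\ m.-primitive_root z) /\
                        abs (x - z) < 1]
  else 0.

(* A rational function in lowest terms: its poles are the roots of [rf_den]. *)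
Record ratfun := RatFun {
  rf_num : {poly C};
  rf_den : {poly C};
  rf_den_neq0 : rf_den != 0;
  rf_coprime : coprimep rf_num rf_den
}.

Definition rf_eval (h : ratfun) (x : C) : C := (rf_num h).[x] / (rf_den h).[x].

Definition rf_pole (h : ratfun) (x : C) : Prop := root (rf_den h) x.

Definition krasner_analytic (D : set C) (f : C -> C) : Prop :=
  exists h : nat -> ratfun,
    (forall n x, rf_pole (h n) x -> ~ D x) /\
    (forall e : R, 0 < e -> exists N, forall n, (N <= n)%N ->
       forall x, D x -> abs (f x - rf_eval (h n) x) < e).

End Cp.

Section ArcNodes.
Variables (R : realType) (p : nat) (C : Cp_tower R p).
Local Notation abs := (@Cp_abs R p C).

Let a0 (x : C) : 0 <= abs x. Proof. by case: (Cp_absP C). Qed.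
Let aM (x y : C) : abs (x * y) = abs x * abs y. Proof. by case: (Cp_absP C). Qed.
Let aD (x y : C) : abs (x + y) <= Num.max (abs x) (abs y).
Proof. by case: (Cp_absP C). Qed.
Let aE (x : C) : abs x = 0 <-> x = 0. Proof. by case: (Cp_absP C). Qed.

Let a1 : abs 1 = 1.
Proof.
have n0 : abs 1 != 0 by apply/eqP => /aE /eqP; rewrite oner_eq0.
by apply: (mulfI n0); rewrite -aM !mulr1.
Qed.

Let aX x n : abs (x ^+ n) = abs x ^+ n.
Proof. by elim: n => [|n IH]; rewrite ?expr0 ?a1 // !exprS aM IH. Qed.

Let aN x : abs (- x) = abs x.
Proof.
rewrite -mulN1r aM; suff -> : abs (-1) = 1 by rewrite mul1r.
by apply: (pexpIrn (n := 2)) => //; rewrite ?nnegrE ?ler01 // -aX sqrrN !expr1n a1.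
Qed.

Let aS (I : Type) (r : seq I) (P : pred I) (F : I -> C) (e : R) : 0 <= e ->
  (forall i, P i -> abs (F i) <= e) -> abs (\sum_(i <- r | P i) F i) <= e.
Proof.
move=> e0 H; apply: (big_ind (fun x => abs x <= e)) => //.
  by have /aE -> : (0 : C) = 0 by [].
by move=> x y hx hy; apply: le_trans (aD _ _) _; rewrite ge_max hx.
Qed.

Let an n : abs n%:R <= 1.
Proof.
elim: n => [|n IH]; first by have /aE -> : (0 : C) = 0 by [].
by rewrite -natr1; apply: le_trans (aD _ _) _; rewrite ge_max IH a1 lexx.
Qed.

Let ap : prime p -> abs p%:R < 1.
Proof.
move=> pp; case: (Cp_completion C) => i1 _ _.
case: (Qp_completion C) => i2 _ _.
rewrite -(rmorph_nat (Cp_of_Qpbar C)) i1 -(rmorph_nat (Qpbar_of_Qp C)).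
rewrite Qpbar_isometry -(rmorph_nat (Qp_of_rat C)) i2 /padic_abs.
have p0 := prime_gt0 pp.
have -> : (p%:R : rat) == 0 = false by rewrite pnatr_eq0; lia.
have -> : (p%:R : rat) = (p%:Z)%:~R by [].
rewrite numq_int denq_int /= logn1 expr0 mul1r logn_prime // eqxx expr1.
by rewrite invf_lt1 ?ltr1n ?ltr0n // prime_gt1.
Qed.

Let root_step (y : C) : prime p -> abs (y ^+ p - 1) < 1 -> abs (y - 1) < 1.
Proof.
move=> pp h; set t := y - 1; rewrite ltNge; apply/negP => t1.
have yE : y ^+ p - 1 = t ^+ p + \sum_(1 <= i < p) t ^+ i *+ 'C(p, i).
  have -> : y = 1 + t by rewrite /t addrC subrK.
  rewrite exprDn -(big_mkord xpredT (fun i => (1 ^+ (p - i) * t ^+ i) *+ 'C(p, i))).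
  rewrite big_nat_recr //= binn mulr1n expr1n mul1r.
  rewrite big_ltn ?prime_gt0 // bin0 mulr1n !expr1n expr0 mulr1.
  rewrite [in LHS]addrAC [LHS]addrC -addrA addKr.
  by congr (_ + _); apply: eq_bigr => i _; rewrite expr1n mul1r.
have tE : t ^+ p = (y ^+ p - 1) - \sum_(1 <= i < p) t ^+ i *+ 'C(p, i).
  by rewrite yE addrK.
have tp : 1 <= abs t ^+ p by rewrite exprn_ege1.
have : abs (t ^+ p) < abs t ^+ p; last by rewrite aX ltxx.
rewrite [in X in X < _]tE; apply: le_lt_trans (aD _ _) _.
rewrite gt_max aN (lt_le_trans h tp) /=.
apply: (@le_lt_trans _ _ (abs p%:R * abs t ^+ p)); last first.
  by rewrite gtr_pMl ?ap // (lt_le_trans ltr01).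
rewrite big_nat; apply: aS => [|i /andP[i1 ip]]; first by rewrite mulr_ge0 ?exprn_ge0.
have /dvdnP [c ->] : (p %| 'C(p, i))%N by apply: prime_dvd_bin; rewrite // i1.
rewrite -mulr_natr natrM !aM aX mulrA mulrC ler_wpM2l //.
apply: le_trans (_ : abs t ^+ i <= _); first by rewrite ler_piMr ?exprn_ge0.
by rewrite ler_weXn2l // ltnW.
Qed.

Lemma arc_node_arc (a b z : C) (n : nat) : prime p -> a != b ->
  (p ^ n)%N.-unity_root z -> arc a b (arc_node a b z).
Proof.
move=> pp ab /unity_rootP zn.
have z1 : abs (z - 1) < 1.
  elim: n z zn => [|n IH] z zn.
    have -> : z - 1 = 0 by rewrite -zn expn0 expr1 subrr.
    by have /aE -> : (0 : C) = 0 by [].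
  by apply: root_step => //; apply: IH; rewrite -exprM -expnS.
rewrite /arc /open_disc /= /arc_node.
have -> : a + (b - a) * z - b = (b - a) * (z - 1).
  by rewrite mulrBr mulr1 opprB -addrA addrCA.
rewrite aM -(aN (b - a)) opprB gtr_pMr // lt_neqAle a0 andbT eq_sym.
by apply/eqP => /aE /eqP; rewrite subr_eq0 (negPf ab).
Qed.

End ArcNodes.

(* Main.v *)
(* The functional f |-> arc_mean a b f n is computed on simple poles:
   1/(x - c) has mean 1/(1 - t^(p^n)) with t = (c - a)/(b - a), which along
   n = alpha + lam k tends to 1/(1 - w(t)^(p^alpha)) for c in a hole and to 0 for
   c outside the big circle.  Sums of simple poles are uniformly dense in the
   Krasner analytic functions (a multiple pole is a limit of simple ones), so all
   that is needed is |arc_mean a b G n| <= rad * sup |G| for such sums, uniformly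
   in n in spite of the factor p^-n.  Means over m-th roots of unity with m prime
   to p have no denominator and are trivially bounded by the sup; letting m grow
   on a circle around a hole they bound the moments sum w (c - x_i)^l of its
   residues, and over the roots of y^m = -1 on the big circle (which avoid the
   residue classes of the holes; p is odd) they bound the moments sum w t^-l of the
   outer poles.  On each group of poles 1/(1 - t^(p^n)) is a convergent integral
   combination of these moments. *)

Require Import Defs.
From mathcomp Require Import all_boot all_order all_algebra.
From mathcomp Require Import cyclic separable cyclotomic.
From mathcomp Require Import all_classical all_reals.
From mathcomp Require Import zify ring lra.

Set Implicit Arguments.
Unset Strict Implicit.
Unset Printing Implicit Defensive.

Import Order.TTheory GRing.Theory Num.Theory.
Local Open Scope classical_set_scope.
Local Open Scope ring_scope.

(** The tower presents [Cp] only as a complete field with a dense copy of the algebraic closure, so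
    factorisations of denominators, roots of unity and Teichmüller representatives have to be
    constructed in it. The value [J i] of a small integral is not read off from [f]: the residue
    sums of the approximants inside hole [i] form a Cauchy sequence, and its limit is both the
    integral around the hole and the coefficient on the large circle. Hence the integral theorem
    asks for one list of simple poles that is at once close to [f] and has residue sums close to the
    [J i]. Density is used again at each fixed [n]: an approximant fine enough to beat [p^-n]
    reduces a comparison of means to pole sums, where the uniform bound applies. One slope [lam], a
    common multiple of the periods of all representatives under the [p]-th power map, gives a single
    path that serves every precision. *)

Lemma exprn_small (R : realType) (k e : R) : 0 <= k < 1 -> 0 < e ->
  exists N, forall n, (N <= n)%N -> k ^+ n < e.
Proof.
case/andP=> k0 k1 e0.
have [->|kn0] := eqVneq k 0; first by exists 1%N => -[|n] // _; rewrite expr0n.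
have kp : 0 < k by rewrite lt_neqAle eq_sym kn0.
pose h := k^-1 - 1; have hp : 0 < h by rewrite subr_gt0 invf_gt1.
have bern n : n%:R * h <= k^-1 ^+ n.
  have -> : k^-1 = 1 + h by rewrite /h addrC subrK.
  elim: n => [|n IH]; first by rewrite mul0r expr0.
  have h1 : 1 <= (1 + h) ^+ n by rewrite exprn_ege1 // lerDl ltW.
  rewrite -natr1 exprS; apply: le_trans (_ : (1 + h) ^+ n + h <= _).
    by rewrite mulrDl mul1r lerD2r.
  by rewrite mulrDl mul1r lerD2l ler_peMr // ltW.
exists (Num.bound (e^-1 / h)) => n Nn.
have : e^-1 < k^-1 ^+ n.
  apply: lt_le_trans (bern n); rewrite -ltr_pdivrMr //.
  apply: lt_le_trans (archi_boundP _) _; first by rewrite divr_ge0 ?invr_ge0 // ltW.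
  by rewrite ler_nat.
by rewrite exprVn ltf_pV2 // posrE exprn_gt0.
Qed.

(** * Ultrametric absolute values and the effect of [p]-th powers *)

Section UltrametricField.
Variables (R : realType) (F : fieldType) (v : F -> R).
Hypothesis vP : ultrametric_abs v.

Lemma uabs_ge0 x : 0 <= v x. Proof. by case: vP. Qed.

Lemma uabsM x y : v (x * y) = v x * v y. Proof. by case: vP. Qed.

Lemma uabs_eq0 x : (v x == 0) = (x == 0).
Proof. by case: vP => _ v0 _ _; apply/eqP/eqP => /v0. Qed.

Lemma uabs0 : v 0 = 0. Proof. by apply/eqP; rewrite uabs_eq0. Qed.

Lemma uabs_gt0 x : (0 < v x) = (x != 0).
Proof. by rewrite lt_neqAle uabs_ge0 andbT eq_sym uabs_eq0. Qed.

Lemma uabs1 : v 1 = 1.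
Proof.
have n0 : v 1 != 0 by rewrite uabs_eq0 oner_eq0.
by apply: (mulfI n0); rewrite -uabsM !mulr1.
Qed.

Lemma uabsX x n : v (x ^+ n) = v x ^+ n.
Proof. by elim: n => [|n IH]; rewrite ?expr0 ?uabs1 // !exprS uabsM IH. Qed.

Lemma uabsV x : v x^-1 = (v x)^-1.
Proof.
have [->|x0] := eqVneq x 0; first by rewrite invr0 uabs0 invr0.
apply: (mulfI (_ : v x != 0)); first by rewrite uabs_eq0.
by rewrite -uabsM !divff ?uabs1 // uabs_eq0.
Qed.

Lemma uabsN x : v (- x) = v x.
Proof.
rewrite -mulN1r uabsM; suff -> : v (-1) = 1 by rewrite mul1r.
apply: (pexpIrn (n := 2)) => //; rewrite ?nnegrE ?ler01 ?uabs_ge0 //.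
by rewrite -uabsX sqrrN !expr1n uabs1.
Qed.

Lemma uabs_sub x y : v (x - y) = v (y - x).
Proof. by rewrite -uabsN opprB. Qed.

Lemma uabsD_le x y e : v x <= e -> v y <= e -> v (x + y) <= e.
Proof.
move=> hx hy; case: vP => _ _ _ h.
by apply: le_trans (h x y) _; rewrite ge_max hx hy.
Qed.

Lemma uabsD_lt x y e : v x < e -> v y < e -> v (x + y) < e.
Proof.
move=> hx hy; case: vP => _ _ _ h.
by apply: le_lt_trans (h x y) _; rewrite gt_max hx hy.
Qed.

Lemma uabsB_le x y e : v x <= e -> v y <= e -> v (x - y) <= e.
Proof. by move=> hx hy; apply: uabsD_le; rewrite ?uabsN. Qed.

Lemma uabsB_lt x y e : v x < e -> v y < e -> v (x - y) < e.
Proof. by move=> hx hy; apply: uabsD_lt; rewrite ?uabsN. Qed.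

Lemma uabs_tr_lt z x y e : v (x - z) < e -> v (z - y) < e -> v (x - y) < e.
Proof. by move=> h1 h2; rewrite -[x](subrK z) -addrA; apply: uabsD_lt. Qed.

Lemma uabs_tr_le z x y e : v (x - z) <= e -> v (z - y) <= e -> v (x - y) <= e.
Proof. by move=> h1 h2; rewrite -[x](subrK z) -addrA; apply: uabsD_le. Qed.

Lemma uabsD_eq x y : v y < v x -> v (x + y) = v x.
Proof.
move=> h; apply/eqP; rewrite eq_le (uabsD_le _ (ltW h)) //=.
rewrite leNgt; apply/negP => h1; have := uabsB_lt h1 h.
by rewrite addrK ltxx.
Qed.

Lemma uabs_dom x y : v (x - y) < v x -> v y = v x.
Proof. by move=> h; rewrite -[y](subKr x) uabsD_eq // uabsN. Qed.

Lemma uabs_sum_le (I : Type) (s : seq I) (P : pred I) (f : I -> F) (e : R) :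
  0 <= e -> (forall i, P i -> v (f i) <= e) -> v (\sum_(i <- s | P i) f i) <= e.
Proof.
move=> e0 H; apply: (big_ind (fun x => v x <= e)) => //; first by rewrite uabs0.
by move=> x y; apply: uabsD_le.
Qed.

Lemma uabs_sum_lt (I : Type) (s : seq I) (P : pred I) (f : I -> F) (e : R) :
  0 < e -> (forall i, P i -> v (f i) < e) -> v (\sum_(i <- s | P i) f i) < e.
Proof.
move=> e0 H; apply: (big_ind (fun x => v x < e)) => //; first by rewrite uabs0.
by move=> x y; apply: uabsD_lt.
Qed.

Lemma uabs_nat n : v n%:R <= 1.
Proof.
elim: n => [|n IH]; first by rewrite uabs0.
by rewrite -natr1; apply: uabsD_le; rewrite ?uabs1.
Qed.

Lemma uabsX_le1 x n : v x <= 1 -> v (x ^+ n) <= 1.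
Proof. by move=> h; rewrite uabsX exprn_ile1 // uabs_ge0. Qed.

Lemma uabsX_lt1 x n : (0 < n)%N -> v x < 1 -> v (x ^+ n) < 1.
Proof. by move=> n0 h; rewrite uabsX exprn_ilt1 ?uabs_ge0 ?gt_eqF. Qed.

Lemma uabsM_le1 x y : v x <= 1 -> v y <= 1 -> v (x * y) <= 1.
Proof. by move=> hx hy; rewrite uabsM mulr_ile1 // uabs_ge0. Qed.

Lemma uabsM_lt1 x y : v x <= 1 -> v y < 1 -> v (x * y) < 1.
Proof.
move=> hx hy; rewrite uabsM; apply: le_lt_trans hy.
by rewrite ler_piMl ?uabs_ge0.
Qed.

Lemma uabsXB_le x y n : v x <= 1 -> v y <= 1 -> v (x ^+ n - y ^+ n) <= v (x - y).
Proof.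
move=> hx hy; rewrite subrXX uabsM ler_piMr ?uabs_ge0 //.
by apply: uabs_sum_le => // i _; rewrite uabsM_le1 ?uabsX_le1.
Qed.

(** If all factors were at least [d], so would be their product compared with [d ^+ size s]. This
    turns a small value of a split polynomial into a nearby root. *)
Lemma uabs_factor_lt (s : seq F) (x : F) (d : R) : 0 < d ->
  v (\prod_(z <- s) (x - z)) < d ^+ size s -> exists2 z, z \in s & v (x - z) < d.
Proof.
move=> d0; elim: s => [|z s IH] /=; first by rewrite big_nil uabs1 expr0 ltxx.
rewrite big_cons uabsM exprS => h.
have [zd|zd] := ltP (v (x - z)) d; first by exists z; rewrite ?mem_head.
case: IH => [|z' z's h']; last by exists z'; rewrite // inE z's orbT.
rewrite ltNge; apply/negP => h1.
have : d * d ^+ size s <= v (x - z) * v (\prod_(j <- s) (x - j)).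
  by rewrite ler_pM // ?exprn_ge0 // ltW.
by rewrite leNgt h.
Qed.

Lemma uabs_small_eq0 x : (forall e, 0 < e -> v x <= e) -> x = 0.
Proof.
move=> h; apply/eqP; rewrite -uabs_eq0 eq_le uabs_ge0 andbT.
by apply/ler_addgt0Pl => e e0; rewrite addr0 h.
Qed.

Lemma uabs_limit_le x B :
  (forall e, 0 < e -> exists2 y, v y <= B & v (x - y) <= e) -> v x <= B.
Proof.
move=> h; apply/ler_addgt0Pl => e e0; have [y yB yx] := h e e0.
have B0 : 0 <= B by apply: le_trans yB; apply: uabs_ge0.
rewrite -[x](subrK y); apply: uabsD_le; first by apply: le_trans yx _; rewrite lerDl.
by apply: le_trans yB _; rewrite lerDr ltW.
Qed.

Variable p : nat.
Hypotheses (p_prime : prime p) (vp : v p%:R < 1).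

Lemma uabs_dvdn n : (p %| n)%N -> v n%:R < 1.
Proof.
by case/dvdnP=> k ->; rewrite natrM uabsM_lt1 // uabs_nat.
Qed.

(* The binomial coefficients [C(p, i)], [0 < i < p], are divisible by [p]. *)
Lemma uabs_frobenius x d : v x <= 1 -> v d <= 1 ->
  v ((x + d) ^+ p - x ^+ p - d ^+ p) <= v p%:R * v d.
Proof.
move=> x1 d1; rewrite exprDn -(big_mkord xpredT (fun i => (x ^+ (p - i) * d ^+ i) *+ 'C(p, i))).
rewrite big_nat_recr //= binn mulr1n subnn expr0 mul1r.
rewrite big_ltn ?prime_gt0 // bin0 mulr1n subn0 expr0 mulr1.
rewrite -[x ^+ p + _ + _]addrA [x ^+ p + _]addrC addrK addrK big_nat.
apply: uabs_sum_le => [|i /andP[i1 ip]]; first by rewrite mulr_ge0 ?uabs_ge0.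
have /dvdnP [c ->] : (p %| 'C(p, i))%N by apply: prime_dvd_bin; rewrite // i1.
have -> : d ^+ i = d * d ^+ i.-1 by rewrite -exprS prednK.
rewrite -mulr_natr natrM.
have -> : x ^+ (p - i) * (d * d ^+ i.-1) * (c%:R * p%:R) =
  (p%:R * d) * (x ^+ (p - i) * d ^+ i.-1 * c%:R) :> F by ring.
rewrite uabsM uabsM ler_piMr ?mulr_ge0 ?uabs_ge0 //.
by rewrite !uabsM_le1 ?uabsX_le1 ?uabs_nat.
Qed.

(** Modulo the maximal ideal [x ^+ p - 1] is [(x - 1) ^+ p]: the residue field has characteristic
    [p], so 1 is its only [p]-th root of unity. *)
Lemma uabs_root_step x : v x <= 1 -> v (x ^+ p - 1) < 1 -> v (x - 1) < 1.
Proof.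
move=> x1 h; have d1 : v (x - 1) <= 1 by apply: uabsB_le; rewrite ?uabs1.
have := uabs_frobenius (_ : v 1 <= 1) d1; rewrite uabs1 => /(_ (lexx _)).
rewrite [1 + _]addrC subrK expr1n => h1.
have h2 : v ((x - 1) ^+ p) < 1.
  rewrite -[X in v X](subKr (x ^+ p - 1)); apply: uabsB_lt => //.
  apply: le_lt_trans h1 _.
  by rewrite mulrC -uabsM uabsM_lt1.
rewrite ltNge; apply/negP => h3.
by move: h2; rewrite uabsX ltNge exprn_ege1.
Qed.

Lemma uabs_root_stepn x n : v x <= 1 -> v (x ^+ (p ^ n) - 1) < 1 -> v (x - 1) < 1.
Proof.
move=> x1; elim: n => [|n IH]; first by rewrite expn0 expr1.
rewrite expnSr exprM => h; apply: IH; apply: uabs_root_step h.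
exact: uabsX_le1.
Qed.

Lemma uabs_expn_lim x y : v x <= 1 -> v y <= 1 -> v (x - y) < 1 ->
  forall e, 0 < e -> exists N, forall n, (N <= n)%N ->
    v (x ^+ (p ^ n) - y ^+ (p ^ n)) < e.
Proof.
(* Each [p]-th power shrinks the difference by the factor [k]: [X ^+ p - Y ^+ p] is [(X - Y) ^+ p]
   up to an error of size at most [v p%:R * v (X - Y)]. *)
move=> x1 y1 xy e e0; set k := Num.max (v (x - y)) (v p%:R).
have k0 : 0 <= k by rewrite le_max uabs_ge0.
have k1 : k < 1 by rewrite gt_max xy.
have H n : v (x ^+ (p ^ n) - y ^+ (p ^ n)) <= k ^+ n.+1.
  elim: n => [|n IH]; first by rewrite expn0 !expr1 le_max lexx.
  rewrite expnSr !exprM; set X := x ^+ _ in IH *; set Y := y ^+ _ in IH *.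
  have Y1 : v Y <= 1 by apply: uabsX_le1.
  have X1 : v X <= 1 by apply: uabsX_le1.
  have d1 : v (X - Y) <= 1 by apply: uabsB_le.
  have dk : v (X - Y) <= k.
    by apply: le_trans IH _; rewrite exprS ler_piMr // exprn_ile1 // ltW.
  have := uabs_frobenius Y1 d1; rewrite [Y + _]addrC subrK => h.
  rewrite -[X in v X](subrK ((X - Y) ^+ p)).
  apply: uabsD_le.
    apply: le_trans h _; rewrite [k ^+ _]exprS ler_pM ?uabs_ge0 //.
    by rewrite le_max lexx orbT.
  rewrite uabsX [k ^+ _]exprS -(prednK (prime_gt0 p_prime)) exprS mulrC.
  rewrite ler_pM ?exprn_ge0 ?uabs_ge0 //.
  case: p p_prime => [|[|q]] //= _; rewrite exprS.
  apply: le_trans dk; rewrite ler_piMr ?uabs_ge0 //.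
  by rewrite exprn_ile1 ?uabs_ge0.
have [|N HN] := @exprn_small R k e _ e0; first by rewrite k0.
exists N => n Nn; apply: le_lt_trans (H n) _.
by apply: HN; rewrite leqW.
Qed.

End UltrametricField.

(** * The completion of an algebraically closed field is algebraically closed *)

Section CompletionOfClosedField.
Variables (R : realType) (F : closedFieldType) (K : fieldType).
Variables (vF : F -> R) (vK : K -> R) (i : {rmorphism F -> K}).
Hypotheses (vP : ultrametric_abs vK) (compl : is_completion vF vK i).

Lemma uabs_horner_le (q : {poly K}) (e B : R) (z : K) :
  0 <= e -> (forall j, vK q`_j <= e) -> 1 <= B -> vK z <= B ->
  vK q.[z] <= e * B ^+ size q.
Proof.
move=> e0 qe B1 zB; rewrite horner_coef; apply: (uabs_sum_le vP) => [|j _].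
  by rewrite mulr_ge0 // exprn_ge0 // (le_trans ler01).
rewrite (uabsM vP) (uabsX vP) ler_pM ?exprn_ge0 ?uabs_ge0 //.
apply: le_trans (_ : B ^+ j <= _).
  by rewrite lerXn2r ?nnegrE ?(le_trans ler01 B1) // uabs_ge0.
by rewrite ler_weXn2l // ltnW.
Qed.

Lemma poly_dense (q : {poly K}) (e : R) : q \is monic -> 0 < e ->
  exists2 q' : {poly F}, q' \is monic & size q' = size q /\
    forall j, vK (q - map_poly i q')`_j < e.
Proof.
move=> qm e0; have [_ dens _] := compl.
pose c j := xget 0 [set x : F | vK (q`_j - i x) < e].
have cP j : vK (q`_j - i (c j)) < e.
  by rewrite /c; case: xgetP => // h; have [x xe] := dens q`_j e e0; case: (h x).
have q0 : q != 0 by apply: monic_neq0.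
have sq : size q = (size q).-1.+1 by rewrite prednK // size_poly_gt0.
(* The leading coefficient stays exactly 1, so the approximant is monic of the same degree. *)
pose q' := \poly_(j < size q) (if j == (size q).-1 then 1 else c j).
have s' : size q' = size q by rewrite size_poly_eq // eqxx oner_eq0.
exists q'; first by rewrite monicE lead_coefE s' coef_poly sq /= ltnSn eqxx.
split=> // j; rewrite coefB coef_map /= coef_poly.
case: ltnP => jq; last by rewrite nth_default // rmorph0 subr0 (uabs0 vP).
case: eqP => [->|_]; last exact: cP.
by rewrite -lead_coefE (monicP qm) rmorph1 subrr (uabs0 vP).
Qed.

(* A monic polynomial close to [q] splits, so one of its roots is close to any
   point where [q] is small. *)
Lemma near_root_step (q : {poly K}) (z : K) (d d' : R) : q \is monic ->
  0 < d -> 0 < d' -> vK q.[z] < d ^+ (size q).-1 ->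
  exists2 z', vK (z - z') < d & vK q.[z'] < d' ^+ (size q).-1.
Proof.
move=> qm d0 d'0 hz; set n := (size q).-1 in hz *.
(* [B] bounds [z] and every point within [d] of it, so that one estimate [close] serves both at [z]
   and at the root [w]. *)
pose B := Num.max 1 (Num.max (vK z) d).
have B1 : 1 <= B by rewrite le_max lexx.
have Bp : 0 < B by apply: lt_le_trans B1.
pose m := Num.min (d ^+ n) (d' ^+ n).
have m0 : 0 < m by rewrite lt_min !exprn_gt0.
pose e := m / B ^+ (size q) / 2.
have e0 : 0 < e by rewrite !divr_gt0 ?exprn_gt0.
have [q' q'm [sq' qq']] := poly_dense qm e0.
have close y : vK y <= B -> vK (q.[y] - (map_poly i q').[y]) < m.
  move=> yB; rewrite -hornerN -hornerD.
  apply: le_lt_trans (_ : e * B ^+ size (q - map_poly i q') < _).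
    by apply: uabs_horner_le => // [|j]; rewrite ltW.
  apply: le_lt_trans (_ : e * B ^+ size q < _).
    rewrite (ler_wpM2l (ltW e0)) // ler_weXn2l //.
    by apply: leq_trans (size_polyD _ _) _; rewrite size_polyN size_map_poly sq' maxnn.
  rewrite /e mulrAC divfK ?gt_eqF ?exprn_gt0 //; lra.
have [s q's] := closed_field_poly_normal q'.
have fact : map_poly i q' = \prod_(w <- map i s) ('X - w%:P).
  rewrite [q']q's (monicP q'm) scale1r rmorph_prod big_map.
  by apply: eq_bigr => w _; rewrite rmorphB /= map_polyX map_polyC.
have ss : size (map i s) = n.
  have := size_prod_XsubC (map i s) id.
  by rewrite -fact size_map_poly sq' /n => ->.
have [|w ws zw] := @uabs_factor_lt R K vK vP (map i s) z d d0.
- rewrite ss; have -> : \prod_(w <- map i s) (z - w) = (map_poly i q').[z].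
    by rewrite fact horner_prod; apply: eq_bigr => w _; rewrite hornerXsubC.
  rewrite -[X in vK X](subKr q.[z]); apply: (uabsB_lt vP) => //.
  apply: lt_le_trans (close z _) _; first by rewrite !le_max lexx orbT.
  by rewrite ge_min lexx.
exists w => //; have w0 : (map_poly i q').[w] = 0.
  by apply/eqP; rewrite -rootE fact root_prod_XsubC.
rewrite -[q.[w]]subr0 -w0; apply: lt_le_trans (close w _) _; last first.
  by rewrite ge_min lexx orbT.
rewrite -[w](subKr z); apply: (uabsB_le vP); first by rewrite !le_max lexx orbT.
by rewrite !le_max (ltW zw) !orbT.
Qed.

(** Iterating [near_root_step] with radii [d k] tending geometrically to 0 gives a Cauchy sequence
    of approximate roots, whose limit is a root. *)
Lemma completion_root (q : {poly K}) : q \is monic -> (1 < size q)%N ->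
  exists z, root q z.
Proof.
move=> qm q1; set n := (size q).-1; have n0 : (0 < n)%N by rewrite /n; lia.
(* [d0] exceeds [vK q.[0]] and is at least 1, so the iteration may start at 0, where [vK q.[0] < d0
   ^+ n]. *)
pose d0 := 1 + vK q.[0]; have d01 : 1 <= d0 by rewrite lerDl uabs_ge0.
pose d k : R := d0 / 2 ^+ k.
have dp k : 0 < d k by rewrite divr_gt0 ?exprn_gt0 // (lt_le_trans ltr01).
have dS k l : (k <= l)%N -> d l <= d k.
  move=> kl; rewrite ler_wpM2l ?(le_trans ler01) // lef_pV2 ?posrE ?exprn_gt0 //.
  by rewrite ler_weXn2l // ler1n.
have step (kz : nat * K) : exists z', vK q.[kz.2] < d kz.1 ^+ n ->
    vK (kz.2 - z') < d kz.1 /\ vK q.[z'] < d kz.1.+1 ^+ n.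
  case: kz => k z /=; have [h|h] := ltP (vK q.[z]) (d k ^+ n); last by exists 0.
  by have [z' h1 h2] := near_root_step qm (dp k) (dp k.+1) h; exists z'.
have [g gP] := choice step.
pose u := fix u k := if k is k'.+1 then g (k', u k') else 0.
have uP k : vK q.[u k] < d k ^+ n.
  elim: k => [|k IH]; last by have [] := gP (k, u k) IH.
  apply: lt_le_trans (_ : d 0 <= _); first by rewrite /d expr0 divr1 ltrDr ltr01.
  by rewrite /d expr0 divr1 ler_eXnr.
have uS k : vK (u k - u k.+1) < d k by have [] := gP (k, u k) (uP k).
have uC N k : (N <= k)%N -> vK (u N - u k) < d N.
  elim: k => [|k IH]; first by rewrite leqn0 => /eqP ->; rewrite subrr (uabs0 vP).
  rewrite leq_eqVlt => /orP[/eqP <-|Nk]; first by rewrite subrr (uabs0 vP).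
  apply: (uabs_tr_lt vP (IH Nk)); apply: lt_le_trans (uS k) _; exact: dS.
have dlim e : 0 < e -> exists N, forall k, (N <= k)%N -> d k < e.
  move=> e0; have [||N HN] := @exprn_small R 2^-1 (e / d0); first by lra.
    by rewrite divr_gt0 // (lt_le_trans ltr01).
  exists N => k Nk; rewrite /d mulrC -exprVn -ltr_pdivlMr ?(lt_le_trans ltr01) //.
  exact: HN.
have [_ _ cK] := compl; have [e e0|l lP] := cK u.
  have [N HN] := dlim e e0; exists N => k l Nk Nl.
  apply: (uabs_tr_lt vP (z := u N)); last by apply: lt_trans (uC _ _ Nl) (HN _ _).
  by rewrite (uabs_sub vP); apply: lt_trans (uC _ _ Nk) (HN _ _).
exists l; apply/eqP; apply: (uabs_small_eq0 vP) => e e0.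
(* Continuity of [q] at [l]: the quotient [r] is bounded by [T] on the points of size at most [B];
   the [+ 1] in [T] keeps it positive. *)
have [r rE] : exists r, q - q.[l]%:P = r * ('X - l%:P).
  by apply/factor_theorem; rewrite rootE !hornerE subrr.
pose B := Num.max 1 (Num.max 1 (vK l)).
pose c := \sum_(j < size r) vK r`_j.
have c0 : 0 <= c by apply: sumr_ge0 => j _; apply: uabs_ge0.
have rc j : vK r`_j <= c.
  have [jr|jr] := ltnP j (size r); last by rewrite nth_default // (uabs0 vP).
  by rewrite /c (bigD1 (Ordinal jr)) //= lerDl sumr_ge0 // => k _; apply: uabs_ge0.
pose T := c * B ^+ size r + 1.
have B1 : 1 <= B by rewrite le_max lexx.
have T0 : 0 < T by rewrite ltr_wpDl // mulr_ge0 ?exprn_ge0 // (le_trans ler01).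
pose e' := Num.min 1 (e / T); have e'0 : 0 < e' by rewrite lt_min ltr01 divr_gt0.
have [N1 H1] := lP e' e'0.
have ed0 : 0 < Num.min 1 e by rewrite lt_min ltr01.
have [N2 H2] := dlim _ ed0.
pose k := (N1 + N2)%N.
have h1 : vK (u k - l) < e' by apply: H1; apply: leq_addr.
have h2 : vK q.[u k] <= e.
  apply: le_trans (ltW (uP k)) _; have := H2 k (leq_addl _ _).
  rewrite lt_min => /andP[dk1 dke]; apply: le_trans (ltW dke).
  by rewrite ler_iXnr ?ltW.
rewrite -[q.[l]](subKr q.[u k]); apply: (uabsB_le vP) => //.
have -> : q.[u k] - q.[l] = r.[u k] * (u k - l).
  by have := congr1 (fun s => s.[u k]) rE; rewrite !hornerE.
rewrite (uabsM vP); apply: le_trans (_ : T * (e / T) <= _); last first.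
  by rewrite mulrC divfK // gt_eqF.
have uB : vK (u k) <= B.
  rewrite -[u k](subrK l); apply: (uabsD_le vP); last by rewrite !le_max lexx !orbT.
  by apply: le_trans (ltW h1) _; rewrite ge_min le_max lexx.
apply: ler_pM; rewrite ?uabs_ge0 //.
  by apply: le_trans (uabs_horner_le c0 rc B1 uB) _; rewrite lerDl.
by apply: le_trans (ltW h1) _; rewrite ge_min lexx orbT.
Qed.

Lemma completion_split (q : {poly K}) : q != 0 ->
  exists s : seq K, q = lead_coef q *: \prod_(z <- s) ('X - z%:P).
Proof.
have [n] := ubnP (size q); elim: n q => // n IH q qn q0.
have lq0 : lead_coef q != 0 by rewrite lead_coef_eq0.
have [q1|q1] := leqP (size q) 1.
  by exists [::]; rewrite big_nil alg_polyC [q in LHS]size1_polyC // lead_coefE;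
     congr (_ %:P); rewrite -subn1; move: q1; case: (size q) => [|[|]].
pose q' := (lead_coef q)^-1 *: q.
have q'm : q' \is monic by rewrite monicE lead_coefZ mulVf.
have [|z] := completion_root q'm; first by rewrite size_scale // invr_eq0.
rewrite /root hornerZ mulf_eq0 invr_eq0 (negPf lq0) /= => /factor_theorem [r rE].
have r0 : r != 0 by apply: contraNneq q0 => r0; rewrite rE r0 mul0r.
have [|//|s sE] := IH r.
  move: qn; rewrite rE size_Mmonic ?monicXsubC // size_XsubC; lia.
exists (z :: s); rewrite big_cons rE lead_coefM lead_coefXsubC mulr1 {1}sE.
by rewrite mulrC scalerAr.
Qed.

End CompletionOfClosedField.

(** * Residue fields, Teichmüller representatives and roots of unity in the tower *)

Section Tower.
Variables (R : realType) (p : nat) (C : Cp_tower R p).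
Hypothesis p_prime : prime p.

Let vQ := Qp_absP C.
Let vB := Qpbar_absP C.
Let vC := Cp_absP C.

Lemma Qp_abs_nat n : Qp_abs (n%:R : Qp C) = padic_abs R p n%:R.
Proof. by have [<- _ _] := Qp_completion C; rewrite rmorph_nat. Qed.

Lemma Qpbar_abs_nat n : Qpbar_abs (n%:R : Qpbar C) = padic_abs R p n%:R.
Proof. by rewrite -(rmorph_nat (Qpbar_of_Qp C)) Qpbar_isometry Qp_abs_nat. Qed.

Lemma Cp_abs_nat n : Cp_abs (n%:R : C) = padic_abs R p n%:R.
Proof.
by have [h _ _] := Cp_completion C; rewrite -(rmorph_nat (Cp_of_Qpbar C)) h Qpbar_abs_nat.
Qed.

Lemma padic_abs_nat n : (0 < n)%N -> padic_abs R p n%:R = (p%:R ^+ logn p n)^-1.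
Proof.
move=> n0; rewrite /padic_abs pnatr_eq0 gt_eqF //.
have -> : (n%:R : rat) = (n%:Z)%:~R by [].
by rewrite numq_int denq_int /= logn1 expr0 mul1r.
Qed.

Lemma padic_abs_p : padic_abs R p p%:R = p%:R^-1.
Proof. by rewrite padic_abs_nat ?prime_gt0 // logn_prime // eqxx expr1. Qed.

Lemma padic_abs_p_lt1 : padic_abs R p p%:R < 1.
Proof. by rewrite padic_abs_p invf_lt1 ?ltr1n ?ltr0n ?prime_gt1 ?prime_gt0. Qed.

Lemma padic_abs_coprime n : ~~ (p %| n)%N -> padic_abs R p n%:R = 1.
Proof.
case: n => [|n]; first by rewrite dvdn0.
by move=> pn; rewrite padic_abs_nat // logn_coprime ?prime_coprime // expr0 invr1.
Qed.

Lemma Cp_nat_neq0 n : (0 < n)%N -> (n%:R : C) != 0.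
Proof.
move=> n0; rewrite -(uabs_gt0 vC) Cp_abs_nat padic_abs_nat // invr_gt0 exprn_gt0 //.
by rewrite ltr0n prime_gt0.
Qed.

Lemma Qp_p_lt1 : Qp_abs (p%:R : Qp C) < 1.
Proof. by rewrite Qp_abs_nat padic_abs_p_lt1. Qed.

Lemma Qpbar_p_lt1 : Qpbar_abs (p%:R : Qpbar C) < 1.
Proof. by rewrite Qpbar_abs_nat padic_abs_p_lt1. Qed.

Lemma Cp_p_lt1 : Cp_abs (p%:R : C) < 1.
Proof. by rewrite Cp_abs_nat padic_abs_p_lt1. Qed.

Lemma Qp_int_near (z : int) : exists n : nat, Qp_abs (z%:~R - n%:R : Qp C) < 1.
Proof.
case: z => m; first by exists m; rewrite subrr (uabs0 vQ).
(* [- (m + 1)] and [(m + 1) * (p - 1)] differ by a multiple of [p]. *)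
exists (m.+1 * (p - 1))%N; rewrite NegzE mulrNz -opprD (uabsN vQ) -[m.+1%:~R]/(m.+1%:R) -natrD.
apply: (uabs_dvdn vQ Qp_p_lt1); rewrite -[X in (X + _)%N]muln1 -mulnDr.
by rewrite subnKC ?prime_gt0 // dvdn_mull.
Qed.

(** The residue field of Q_p is the prime field: an integral rational number has denominator prime
    to [p], which is inverted modulo [p]. *)
Lemma Qp_integer_near (q : Qp C) : Qp_abs q <= 1 ->
  exists n : nat, Qp_abs (q - n%:R) < 1.
Proof.
move=> q1; have [_ dens _] := Qp_completion C.
have [w qw] := dens q 1 ltr01.
suff [n wn] : exists n : nat, Qp_abs (Qp_of_rat C w - n%:R) < 1.
  by exists n; apply: (uabs_tr_lt vQ qw).
have w1 : Qp_abs (Qp_of_rat C w) <= 1.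
  by rewrite -[Qp_of_rat C w](subKr q); apply: (uabsB_le vQ); rewrite // ltW.
set num := numq w; pose d := `|denq w|%N.
have dE : denq w = d by rewrite /d gez0_abs.
have wE : Qp_of_rat C w * d%:R = num%:~R.
  rewrite -[w in LHS]divq_num_den fmorph_div !rmorph_int dE divfK //.
  by rewrite -(uabs_gt0 vQ) Qp_abs_nat padic_abs_nat ?absz_gt0 ?denq_eq0 //
    invr_gt0 exprn_gt0 // ltr0n prime_gt0.
have absz_int (z : int) : Qp_abs (z%:~R : Qp C) = Qp_abs (`|z|%N%:R : Qp C).
  by case: z => // m; rewrite NegzE mulrNz (uabsN vQ).
have pd : ~~ (p %| d)%N.
  apply/negP => pd; have pn : ~~ (p %| `|num|)%N.
    apply/negP => pn; have := coprime_num_den w.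
    rewrite /coprime => /eqP g1; have : (p %| 1)%N by rewrite -g1 dvdn_gcd pn.
    by rewrite dvdn1 => /eqP p1; move: p_prime; rewrite p1.
  have : Qp_abs (Qp_of_rat C w * d%:R) < 1.
    by apply: (uabsM_lt1 vQ) => //; apply: (uabs_dvdn vQ Qp_p_lt1).
  by rewrite wE absz_int Qp_abs_nat padic_abs_coprime // ltxx.
(* [a * d] is [-1] modulo [p], so [- num * a] represents the fraction [num / d]. *)
have [a _ pad] := Bezoutl d (prime_gt0 p_prime).
have [n hn] := Qp_int_near (- num * a%:Z).
exists n; have d1 : Qp_abs (d%:R : Qp C) = 1 by rewrite Qp_abs_nat padic_abs_coprime.
rewrite -[X in X < _]mulr1 -[X in _ * X < _]d1 -(uabsM vQ) mulrBl wE.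
have -> : num%:~R - n%:R * d%:R =
    num%:~R * (1 + a * d)%N%:R + ((- num * a%:Z)%:~R - n%:R) * d%:R :> Qp C.
  rewrite natrD natrM intrM mulrNz -[a%:Z%:~R]/(a%:R); ring.
apply: (uabsD_lt vQ).
  apply: (uabsM_lt1 vQ); first by rewrite absz_int uabs_nat.
  apply: (uabs_dvdn vQ Qp_p_lt1); move: pad.
  by move: pd; rewrite -prime_coprime // /coprime => /eqP ->.
by rewrite mulrC; apply: (uabsM_lt1 vQ); rewrite ?d1.
Qed.

(** An annihilating polynomial is divided by its coefficient of largest absolute value; among
    several, the one of highest index is taken, so that all later coefficients become small and the
    reduction is monic over the prime field. *)
Lemma Qpbar_residue_monic (y : Qpbar C) : Qpbar_abs y = 1 ->
  exists (d : nat) (n : nat -> nat),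
    Qpbar_abs (y ^+ d - \sum_(j < d) (n j)%:R * y ^+ j) < 1.
Proof.
move=> y1; have [q q0 qy] := Qpbar_algebraic y.
set j := @Qpbar_of_Qp R p C in qy.
have q_gt0 : (0 < size q)%N by rewrite size_poly_gt0.
pose top (l : 'I_(size q)) := [forall k : 'I_(size q), Qp_abs q`_k <= Qp_abs q`_l].
have [l0 topl0] : exists l0, top l0.
  have [l0 _ l0P] := @Order.TotalTheory.arg_maxP _ R _ (Ordinal q_gt0) xpredT (fun k => Qp_abs q`_k) isT.
  by exists l0; apply/forallP => k; apply: l0P.
case: (@arg_maxnP _ l0 top (@nat_of_ord _) topl0) => l topl lmax {l0 topl0}.
have topl' k : Qp_abs q`_k <= Qp_abs q`_l.
  have [kq|kq] := ltnP k (size q); first by move/forallP: topl => /(_ (Ordinal kq)).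
  by rewrite nth_default // (uabs0 vQ) uabs_ge0.
have ltop k : (l < k)%N -> Qp_abs q`_k < Qp_abs q`_l.
  move=> lk; rewrite lt_neqAle topl' andbT; apply/negP => /eqP e.
  have [kq|kq] := ltnP k (size q); last first.
    move: e; rewrite nth_default // (uabs0 vQ) => /esym e0.
    have := topl' (size q).-1; rewrite -lead_coefE e0 => h.
    have : Qp_abs (lead_coef q) == 0 by rewrite eq_le h uabs_ge0.
    by rewrite (uabs_eq0 vQ) lead_coef_eq0 (negPf q0).
  suff topk : top (Ordinal kq) by have := lmax _ topk; rewrite /= leqNgt lk.
  by apply/forallP => k' /=; rewrite e.
have ql0 : q`_l != 0.
  apply/eqP => ql0; have := topl' (size q).-1; rewrite -lead_coefE ql0 (uabs0 vQ) => h.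
  have : Qp_abs (lead_coef q) == 0 by rewrite eq_le h uabs_ge0.
  by rewrite (uabs_eq0 vQ) lead_coef_eq0 (negPf q0).
pose c k := q`_k / q`_l.
have cle k : Qp_abs (- c k) <= 1.
  rewrite (uabsN vQ) (uabsM vQ) (uabsV vQ) ler_pdivrMr ?mul1r //.
  by rewrite (uabs_gt0 vQ).
have clt k : (l < k)%N -> Qp_abs (c k) < 1.
  move=> lk; rewrite (uabsM vQ) (uabsV vQ) ltr_pdivrMr ?mul1r ?ltop //.
  by rewrite (uabs_gt0 vQ).
have [n nP] := choice (fun k => Qp_integer_near (cle k)).
exists l, n.
have : \sum_(k < size q) j (c k) * y ^+ k = 0.
  have : (map_poly j q).[y] = 0 by apply/eqP.
  rewrite horner_coef size_map_poly => h.
  rewrite -[RHS](mulr0 (j q`_l)^-1) -[X in _ = _ * X]h mulr_sumr; apply: eq_bigr => k _.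
  by rewrite coef_map /= fmorph_div mulrA [_^-1 * _]mulrC.
have ls : (l < size q)%N by [].
rewrite -(big_mkord xpredT (fun k => j (c k) * y ^+ k)).
rewrite (big_cat_nat (n := l)) ?(ltnW ls) //= [X in _ + X]big_ltn //.
rewrite {2}/c divff // rmorph1 mul1r big_mkord => h0.
have -> : y ^+ l - \sum_(k < l) (n k)%:R * y ^+ k =
   \sum_(k < l) j (- c k - (n k)%:R) * y ^+ k - \sum_(l.+1 <= k < size q) j (c k) * y ^+ k.
  have -> : \sum_(k < l) j (- c k - (n k)%:R) * y ^+ k =
     - (\sum_(k < l) j (c k) * y ^+ k) - \sum_(k < l) (n k)%:R * y ^+ k.
    rewrite -sumrN -sumrB; apply: eq_bigr => k _.
    by rewrite rmorphB rmorphN rmorph_nat mulrBl mulNr.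
  move: h0; set s1 := \sum_(k < l) _; set s2 := \sum_(_ <= _ < _) _; set s3 := \sum_(k < l) _.
  move=> h0; have -> : y ^+ l = - s1 - s2 by apply/eqP; rewrite -subr_eq0 -h0; apply/eqP; ring.
  ring.
have yX k : Qpbar_abs (y ^+ k) = 1 by rewrite (uabsX vB) y1 expr1n.
apply: (uabsB_lt vB).
  apply: (uabs_sum_lt vB) => // k _.
  by rewrite (uabsM vB) yX mulr1 Qpbar_isometry.
rewrite big_nat; apply: (uabs_sum_lt vB) => // k /andP[lk _].
by rewrite (uabsM vB) yX mulr1 Qpbar_isometry clt.
Qed.

(* Pigeonhole: modulo the maximal ideal the powers of [y] lie in the finite set
   of combinations of [1, y, ..., y^(d-1)] with coefficients in [0, p). *)
Lemma Qpbar_residue_torsion (y : Qpbar C) : Qpbar_abs y = 1 ->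
  exists2 m, (0 < m)%N & Qpbar_abs (y ^+ m - 1) < 1.
Proof.
move=> y1; have [d [n dP]] := Qpbar_residue_monic y1.
have yX k : Qpbar_abs (y ^+ k) = 1 by rewrite (uabsX vB) y1 expr1n.
pose ev (c : nat -> nat) := \sum_(j < d) (c j)%:R * y ^+ j.
have evm c : Qpbar_abs (ev c - ev (fun j => c j %% p)%N) < 1.
  rewrite -sumrB; apply: (uabs_sum_lt vB) => // j _.
  rewrite -mulrBl (uabsM vB) yX mulr1 {1}(divn_eq (c j) p) natrD addrK.
  by apply: (uabs_dvdn vB Qpbar_p_lt1); rewrite dvdn_mull.
have pw k : exists c : nat -> nat, Qpbar_abs (y ^+ k - ev c) < 1.
  elim: k => [|k [c IH]].
    case: d @ev dP evm => [|d] ev dP evm.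
      by move: dP; rewrite big_ord0 expr0 => dP; exists n; rewrite /ev big_ord0.
    exists (fun j => (j == 0)%N : nat); rewrite /ev big_ord_recl /= mul1r expr0.
    by rewrite big1 ?addr0 ?subrr ?(uabs0 vB) // => j _; rewrite mul0r.
  case: d @ev dP evm IH => [|d] ev dP evm IH.
    by exists n; move: IH; rewrite /ev big_ord0 subr0 yX ltxx.
  (* Multiplication by [y] shifts the coefficients, and the overflow [c d * y ^+ d.+1] is replaced
     by means of the monic relation. *)
  exists (fun j => (if j is j'.+1 then c j' else 0) + c d * n j)%N.
  apply: (uabs_tr_lt vB (z := y * ev c)).
    by rewrite exprS -mulrBr; apply: (uabsM_lt1 vB) => //; rewrite y1.
  have -> : y * ev c - ev (fun j => (if j is j'.+1 then c j' else 0) + c d * n j)%N =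
     (c d)%:R * (y ^+ d.+1 - \sum_(j < d.+1) (n j)%:R * y ^+ j).
    have -> : ev (fun j => (if j is j'.+1 then c j' else 0) + c d * n j)%N =
      \sum_(j < d.+1) (if (j : nat) is j'.+1 then c j' else 0)%:R * y ^+ j +
      (c d)%:R * \sum_(j < d.+1) (n j)%:R * y ^+ j.
      rewrite mulr_sumr -big_split /=; apply: eq_bigr => j _.
      by rewrite natrD natrM mulrDl mulrA.
    rewrite big_ord_recl mul0r add0r /ev big_ord_recr /= mulrDr.
    rewrite mulrBr opprD addrA; congr (_ - _).
    rewrite mulr_sumr (eq_bigr (fun i : 'I_d => (c i)%:R * y ^+ i.+1)); last first.
      by move=> i _; rewrite exprS mulrCA.
    by rewrite addrAC subrr add0r mulrCA -exprS.
  by apply: (uabsM_lt1 vB) => //; apply: uabs_nat.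
have [c cP] := choice pw.
pose g (k : 'I_(p ^ d).+1) : {ffun 'I_d -> 'I_p} :=
  [ffun j : 'I_d => Ordinal (ltn_pmod (c k j) (prime_gt0 p_prime))].
have /injectivePn [k [l kl gkl]] : ~~ injectiveb g.
  apply/negP => /injectiveP /leq_card; rewrite card_ord card_ffun !card_ord.
  by rewrite ltnn.
have close k' l' : g k' = g l' -> Qpbar_abs (y ^+ k' - y ^+ l') < 1.
  move=> e; apply: (uabs_tr_lt vB (cP k')).
  rewrite (uabs_sub vB); apply: (uabs_tr_lt vB (cP l')); rewrite (uabs_sub vB).
  apply: (uabs_tr_lt vB (evm _)).
  have -> : ev (fun j => c k' j %% p)%N = ev (fun j => c l' j %% p)%N.
    apply: eq_bigr => j _; congr (_%:R * _).
    by move/ffunP/(_ j): e; rewrite !ffunE => /(congr1 val).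
  by rewrite (uabs_sub vB).
wlog lt_kl : k l kl gkl / (k < l)%N.
  move=> W; case: (ltngtP k l) => [h|h|h]; [exact: (W k l)| |].
    by apply: (W l k) => //; rewrite eq_sym.
  by case/eqP: kl; apply: val_inj.
exists (l - k)%N; first by rewrite subn_gt0.
have := close l k (esym gkl).
have -> : y ^+ l - y ^+ k = y ^+ k * (y ^+ (l - k) - 1).
  by rewrite mulrBr mulr1 -exprD subnKC // ltnW.
by rewrite (uabsM vB) yX mul1r.
Qed.

(** A close [y] in the algebraic closure is torsion modulo the maximal ideal, and by
    [uabs_root_stepn] already of order prime to [p] there. Then [y ^+ m' - 1], a product over the
    roots of unity of order dividing [m'], is small, so one factor is. *)
Lemma teichmuller_exists (t : C) : Cp_abs t = 1 ->
  exists z : C, (exists m, coprime m p /\ m.-primitive_root z) /\ Cp_abs (t - z) < 1.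
Proof.
move=> t1; have [iso dens _] := Cp_completion C.
have [y ty] := dens t 1 ltr01.
have y1 : Qpbar_abs y = 1 by rewrite -iso -t1; apply: (uabs_dom vC); rewrite t1.
have [m m0 ym] := Qpbar_residue_torsion y1.
pose m' := (m`_p^')%N; have m'0 : (0 < m')%N by apply: part_gt0.
have pm' : coprime m' p.
  by rewrite coprime_sym prime_coprime // -(p'natE _ p_prime) part_pnat.
have ym' : Qpbar_abs (y ^+ m' - 1) < 1.
  apply: (uabs_root_stepn vB p_prime Qpbar_p_lt1 (n := logn p m)).
    by rewrite (uabsX vB) y1 expr1n.
  by rewrite -exprM /m' mulnC -p_part partnC.
have Xm : ('X^m' - 1 : {poly Qpbar C}) \is monic by apply: monicXnsubC.
have [s sE] := closed_field_poly_normal ('X^m' - 1 : {poly Qpbar C}).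
move: sE; rewrite (monicP Xm) scale1r => sE.
have ss : size s = m'.
  have := size_prod_XsubC s id; rewrite -sE size_XnsubC //; by case.
have [||z zs yz] := @uabs_factor_lt _ _ _ vB s y 1.
- by [].
- rewrite expr1n; have -> : \prod_(z <- s) (y - z) = y ^+ m' - 1.
    have := congr1 (fun q => q.[y]) sE; rewrite !hornerE => ->.
    by rewrite horner_prod; apply: eq_bigr => z _; rewrite hornerXsubC.
  by [].
have zm : z ^+ m' = 1.
  have : root ('X^m' - 1) z by rewrite sE root_prod_XsubC.
  by rewrite /root !hornerE subr_eq0 => /eqP.
have [k zk km] := prim_order_exists m'0 zm.
exists (Cp_of_Qpbar C z); split.
  by exists k; rewrite fmorph_primitive_root (coprime_dvdl km).
apply: (uabs_tr_lt vC ty); by rewrite -rmorphB iso.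
Qed.

(* Junk value 0 included: [teichmuller] vanishes on the open unit disc. *)
Lemma teichmullerP (t : C) : Cp_abs t <= 1 ->
  Cp_abs (t - teichmuller t) < 1 /\
  exists2 l, (0 < l)%N & teichmuller t ^+ (p ^ l) = teichmuller t.
Proof.
rewrite le_eqVlt /teichmuller => /orP[/eqP t1|t1]; last first.
  rewrite lt_eqF // subr0; split=> //; exists 1%N => //.
  by rewrite expr0n expn1 gtn_eqF ?prime_gt0.
rewrite t1 eqxx; case: xgetP => [z _ [[m [mp zm]] tz]|h]; last first.
  by have [z zP] := teichmuller_exists t1; case: (h z).
(* By Euler's theorem [p ^ totient m] is 1 modulo the order [m]. *)
split=> //; exists (totient m).
  by rewrite totient_gt0 (prim_order_gt0 zm).
by rewrite -[RHS]expr1; apply/eqP; rewrite (eq_prim_root_expr zm) Euler_exp_totient // coprime_sym.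
Qed.

Lemma Cp_root_exists (q : {poly C}) : q \is monic -> (1 < size q)%N -> exists z, root q z.
Proof. exact: (completion_root vC (Cp_completion C)). Qed.

(** In characteristic zero ['X^n - 1] is separable also when [p] divides [n], so it has [n] distinct
    roots. *)
Lemma Cp_prim_root n : (0 < n)%N -> exists z : C, n.-primitive_root z.
Proof.
move=> n0; have Xn : ('X^n - 1 : {poly C}) \is monic by apply: monicXnsubC.
have [s sE] := completion_split vC (Cp_completion C) (monic_neq0 Xn).
move: sE; rewrite (monicP Xn) scale1r => sE.
have ss : size s = n.
  have := size_prod_XsubC s id; rewrite -sE size_XnsubC //; by case.
have /hasP [z _ zn] : has n.-primitive_root s; last by exists z.
apply: has_prim_root; rewrite ?ss //.
  by apply/allP => z zs; rewrite /root_of_unity sE root_prod_XsubC.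
rewrite -separable_prod_XsubC -sE; apply: separable_Xn_sub_1; exact: Cp_nat_neq0.
Qed.

End Tower.

(** Pairs are (residue, pole). Poles may be repeated, so that concatenation of lists is addition. *)
Definition pole_sum (F : fieldType) (s : seq (F * F)) (x : F) : F :=
  \sum_(wc <- s) wc.1 / (x - wc.2).

(** * Density of sums of simple poles *)

Section PoleSumApproximation.
Variables (R : realType) (F : fieldType) (v : F -> R).
Hypothesis vP : ultrametric_abs v.
Variable D : set F.

Definition poles_off (s : seq (F * F)) : Prop :=
  forall wc, wc \in s -> ~ D wc.2.

Definition pole_approx (f : F -> F) : Prop :=
  forall e : R, 0 < e -> exists2 s, poles_off s &
    forall x, D x -> v (f x - pole_sum s x) <= e.

Lemma pole_approx_lim f :
  (forall e, 0 < e -> exists2 g, pole_approx g & forall x, D x -> v (f x - g x) <= e) ->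
  pole_approx f.
Proof.
move=> h e e0; have [g ga fg] := h e e0; have [s sD gs] := ga e e0.
by exists s => // x Dx; apply: (uabs_tr_le vP (fg x Dx) (gs x Dx)).
Qed.

Lemma eq_pole_approx f g : (forall x, D x -> f x = g x) -> pole_approx f -> pole_approx g.
Proof.
move=> fg fa; apply: pole_approx_lim => e e0; exists f => // x Dx.
by rewrite fg // subrr (uabs0 vP) ltW.
Qed.

Lemma pole_approx0 : pole_approx (fun=> 0).
Proof.
move=> e e0; exists [::] => // x _.
by rewrite /pole_sum big_nil subrr (uabs0 vP) ltW.
Qed.

Lemma pole_approxD f g : pole_approx f -> pole_approx g -> pole_approx (fun x => f x + g x).
Proof.
move=> fa ga e e0; have [s sD fs] := fa e e0; have [s' s'D gs] := ga e e0.
exists (s ++ s'); first by move=> wc; rewrite mem_cat => /orP[/sD|/s'D].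
move=> x Dx; rewrite /pole_sum big_cat opprD addrACA.
by apply: (uabsD_le vP); [apply: fs|apply: gs].
Qed.

Lemma pole_approxZ c f : pole_approx f -> pole_approx (fun x => c * f x).
Proof.
have [->|c0] := eqVneq c 0.
  by move=> _; apply: eq_pole_approx pole_approx0 => x _; rewrite mul0r.
move=> fa e e0; have vc : 0 < v c by rewrite (uabs_gt0 vP).
have [s sD fs] := fa (e / v c) (divr_gt0 e0 vc).
exists [seq (c * wc.1, wc.2) | wc <- s].
  by move=> _ /mapP [wc ws ->] /=; apply: sD.
move=> x Dx; have -> : pole_sum [seq (c * wc.1, wc.2) | wc <- s] x = c * pole_sum s x.
  by rewrite /pole_sum big_map mulr_sumr; apply: eq_bigr => wc _ /=; rewrite mulrA.
by rewrite -mulrBr (uabsM vP) mulrC -ler_pdivlMr // fs.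
Qed.

Lemma pole_approx_pole c : ~ D c -> pole_approx (fun x => (x - c)^-1).
Proof.
move=> Dc e e0; exists [:: (1, c)]; first by move=> wc; rewrite inE => /eqP ->.
by move=> x _; rewrite /pole_sum big_seq1 /= mul1r subrr (uabs0 vP) ltW.
Qed.

(** Boundedness of [g] controls the error of the approximation of [f], and linearity reduces the
    rest to single poles. *)
Lemma pole_approx_mul (g f : F -> F) (K : R) :
  (forall x, D x -> v (g x) <= K) ->
  (forall c, ~ D c -> pole_approx (fun x => g x * (x - c)^-1)) ->
  pole_approx f -> pole_approx (fun x => g x * f x).
Proof.
move=> gK gc fa; apply: pole_approx_lim => e e0.
pose K' := Num.max K 1; have K'0 : 0 < K' by rewrite lt_max ltr01 orbT.
have [s sD fs] := fa (e / K') (divr_gt0 e0 K'0).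
exists (fun x => g x * pole_sum s x).
  elim: s sD {fs} => [|[w c] s IH] sD.
    apply: eq_pole_approx pole_approx0 => x _.
    by rewrite /pole_sum big_nil mulr0.
  have Dc : ~ D c by apply: (sD (w, c)); rewrite mem_head.
  apply: eq_pole_approx (pole_approxD (pole_approxZ w (gc c Dc)) (IH _)) => [x _|wc ws].
    by rewrite /pole_sum big_cons /= mulrDr mulrCA.
  by apply: sD; rewrite inE ws orbT.
move=> x Dx; rewrite -mulrBr (uabsM vP).
apply: le_trans (_ : K' * (e / K') <= _); last by rewrite mulrC divfK ?gt_eqF.
by apply: ler_pM; rewrite ?uabs_ge0 ?fs // le_max gK.
Qed.

Variables (B : R) (pi : F).
Hypotheses (D_bounded : forall x, D x -> v x <= B)
  (D_separated : forall c, ~ D c -> exists2 d, 0 < d & forall x, D x -> d <= v (x - c))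
  (pi0 : pi != 0) (pi1 : v pi < 1).

Lemma uabs_pi_small e : 0 < e -> exists N, forall n, (N <= n)%N -> v (pi ^+ n) < e.
Proof.
move=> e0; have [|N HN] := @exprn_small R (v pi) e _ e0; first by rewrite (uabs_ge0 vP).
by exists N => n Nn; rewrite (uabsX vP) HN.
Qed.

Lemma pole_approx_mul_pole c f : ~ D c -> pole_approx f ->
  pole_approx (fun x => (x - c)^-1 * f x).
Proof.
move=> Dc; have [d d0 dc] := D_separated Dc.
have xc x : D x -> x - c != 0.
  by move=> Dx; rewrite -(uabs_gt0 vP); apply: lt_le_trans d0 (dc x Dx).
apply: (@pole_approx_mul _ _ d^-1) => [x Dx|c' Dc'].
  by rewrite (uabsV vP) lef_pV2 ?posrE ?(uabs_gt0 vP) ?xc // dc.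
(* Partial fractions for two distinct poles. *)
have neq c1 : c1 != c -> ~ D c1 -> pole_approx (fun x => (x - c)^-1 * (x - c1)^-1).
  move=> c1c Dc1; have := pole_approxZ (c - c1)^-1
    (pole_approxD (pole_approx_pole Dc) (pole_approxZ (-1) (pole_approx_pole Dc1))).
  apply: eq_pole_approx => x Dx; field.
  have xc1 : x - c1 != 0.
    by rewrite subr_eq0; apply/eqP => xE; apply: Dc1; rewrite -xE.
  by rewrite xc1 xc // subr_eq0 eq_sym.
have [->{c' Dc'}|] := eqVneq c' c; last by move=> /neq; apply.
(* A double pole is a limit of pairs of nearby simple poles. *)
apply: pole_approx_lim => e e0.
(* Displacing one pole by [h] costs [v h / v (x - c) ^+ 3], at most [v h / d ^+ 3]; and [v h < d]
   keeps all distances to [D], so the displaced pole is still off [D]. *)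
have ed : 0 < Num.min d (e * d ^+ 3) by rewrite lt_min d0 mulr_gt0 ?exprn_gt0.
have [N /(_ N (leqnn N))] := uabs_pi_small ed.
rewrite lt_min => /andP[pd pe]; set h := pi ^+ N in pd pe.
have xh x : D x -> v (x - (c + h)) = v (x - c).
  move=> Dx; rewrite opprD addrA; apply: (uabsD_eq vP).
  by rewrite (uabsN vP); apply: lt_le_trans (dc x Dx).
have h0 : h != 0 by rewrite expf_eq0 (negPf pi0) andbF.
have Dch : ~ D (c + h).
  move=> /xh /eqP; rewrite subrr (uabs0 vP) addrAC subrr add0r eq_sym.
  by rewrite (uabs_eq0 vP) (negPf h0).
exists (fun x => (x - c)^-1 * (x - (c + h))^-1).
  by apply: neq => //; rewrite -subr_eq0 addrAC subrr add0r.
move=> x Dx; have xch : x - (c + h) != 0.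
  by rewrite -(uabs_gt0 vP) xh // (uabs_gt0 vP) xc.
have -> : (x - c)^-1 * (x - c)^-1 - (x - c)^-1 * (x - (c + h))^-1 =
   - h * ((x - c)^-1 * (x - c)^-1 * (x - (c + h))^-1).
  field; rewrite ?xch ?xc //.
rewrite !(uabsM vP) !(uabsV vP) (uabsN vP) xh // -!invfM -expr2 -exprSr.
rewrite ler_pdivrMr ?exprn_gt0 ?(uabs_gt0 vP) ?xc //.
apply: le_trans (ltW pe) _; rewrite (ler_wpM2l (ltW e0)) //.
by rewrite lerXn2r ?nnegrE ?dc // ?(uabs_ge0 vP) // ltW.
Qed.

(** A constant is a simple pole pushed to infinity: [- c / (x - c)] tends to 1 uniformly on a
    bounded set as [c] grows. *)
Lemma pole_approx1 : pole_approx (fun=> 1).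
Proof.
apply: pole_approx_lim => e e0.
pose B' := Num.max B 1; have B'0 : 0 < B' by rewrite lt_max ltr01 orbT.
have DB x : D x -> v x <= B' by move=> Dx; rewrite le_max D_bounded.
have ed : 0 < Num.min (B'^-1) (e / B') by rewrite lt_min invr_gt0 B'0 divr_gt0.
have [N /(_ N (leqnn N))] := uabs_pi_small ed.
set c := (pi ^+ N)^-1; have c0 : c != 0 by rewrite invr_eq0 expf_eq0 (negPf pi0) andbF.
have -> : pi ^+ N = c^-1 by rewrite invrK.
have vc : 0 < v c by rewrite (uabs_gt0 vP).
rewrite lt_min (uabsV vP) ltf_pV2 ?posrE // => /andP[Bc cB].
have vxc x : D x -> v (x - c) = v c.
  move=> Dx; rewrite addrC -[RHS](uabsN vP); apply: (uabsD_eq vP).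
  by rewrite (uabsN vP); apply: le_lt_trans Bc; apply: DB.
have Dc : ~ D c by move=> /DB; rewrite leNgt Bc.
exists (fun x => - c * (x - c)^-1).
  exact: pole_approxZ (pole_approx_pole Dc).
move=> x Dx; have xc : x - c != 0 by rewrite -(uabs_gt0 vP) vxc.
have -> : 1 - - c * (x - c)^-1 = x * (x - c)^-1 by field.
rewrite (uabsM vP) (uabsV vP) vxc //.
apply: le_trans (_ : B' * (e / B') <= _); last by rewrite mulrC divfK ?gt_eqF.
by apply: ler_pM; rewrite ?DB ?invr_ge0 ?uabs_ge0 // ltW.
Qed.

Lemma pole_approx_mulX f : pole_approx f -> pole_approx (fun x => x * f x).
Proof.
apply: (@pole_approx_mul _ _ B) => // c Dc.
apply: eq_pole_approx (pole_approxD pole_approx1 (pole_approxZ c (pole_approx_pole Dc))) => x Dx.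
field; rewrite subr_eq0; apply/eqP => xc; apply: Dc; by rewrite -xc.
Qed.

Lemma pole_approx_poly (q : {poly F}) : pole_approx (fun x => q.[x]).
Proof.
elim/poly_ind: q => [|q c IH].
  by apply: eq_pole_approx pole_approx0 => x _; rewrite horner0.
apply: eq_pole_approx (pole_approxD (pole_approx_mulX IH) (pole_approxZ c pole_approx1)) => x _.
by rewrite !hornerE mulrC.
Qed.

Lemma pole_approx_frac (q : {poly F}) (s : seq F) : (forall c, c \in s -> ~ D c) ->
  pole_approx (fun x => q.[x] / (\prod_(c <- s) ('X - c%:P)).[x]).
Proof.
elim: s => [|c s IH] sD.
  apply: eq_pole_approx (pole_approx_poly q) => x _.
  by rewrite big_nil hornerC divr1.
have sD' c' : c' \in s -> ~ D c' by move=> c's; apply: sD; rewrite inE c's orbT.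
have Dc : ~ D c by apply: sD; rewrite mem_head.
apply: eq_pole_approx (pole_approx_mul_pole Dc (IH sD')) => x _.
by rewrite big_cons hornerM hornerXsubC invfM mulrCA.
Qed.

End PoleSumApproximation.

(** * Means of a simple pole over roots of unity *)

Section NodeSums.
Variable F : fieldType.

Lemma prim_power_sum (m l : nat) (z : F) : m.-primitive_root z -> ~~ (m %| l)%N ->
  \sum_(i < m) (z ^+ i) ^+ l = 0.
Proof.
move=> zm ml; have zl : z ^+ l - 1 != 0.
  by rewrite subr_eq0 -(prim_order_dvd zm).
apply: (mulfI zl); rewrite mulr0.
rewrite (eq_bigr (fun i : 'I_m => (z ^+ l) ^+ i)); last by move=> i _; rewrite exprAC.
by rewrite -subrX1 exprAC (prim_expr_order zm) expr1n subrr.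
Qed.

(* Multiply by [y0^m - u^m = y^m - u^m] and expand the geometric sum: only one
   power sum of the nodes [y = y0 z^i] survives. *)
Lemma node_sum (m e : nat) (z y0 u : F) : m.-primitive_root z -> (e < m)%N ->
  u ^+ m != y0 ^+ m ->
  \sum_(i < m) (y0 * z ^+ i) ^+ e.+1 / (y0 * z ^+ i - u) =
  m%:R * (y0 ^+ m * u ^+ e / (y0 ^+ m - u ^+ m)).
Proof.
move=> zm em um; have d0 : y0 ^+ m - u ^+ m != 0 by rewrite subr_eq0 eq_sym.
have ym i : (y0 * z ^+ i) ^+ m = y0 ^+ m.
  by rewrite exprMn exprAC (prim_expr_order zm) expr1n mulr1.
have yu i : y0 * z ^+ i - u != 0.
  by apply: contraNneq um => /eqP; rewrite subr_eq0 => /eqP <-; rewrite ym.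
apply: (mulIf d0); rewrite mulr_suml -!mulrA mulVf // mulr1.
rewrite (eq_bigr (fun i : 'I_m => \sum_(k < m)
    y0 ^+ (e.+1 + (m.-1 - k)) * u ^+ k * (z ^+ i) ^+ (e.+1 + (m.-1 - k)))); last first.
  move=> i _; rewrite -(ym i) subrXX mulrA divfK // mulr_sumr.
  apply: eq_bigr => k _; by rewrite mulrA -exprD exprMn mulrAC.
(* The exponent [m + e - k] lies strictly between 0 and [2 * m], hence is a multiple of [m] only for
   [k = e]. *)
rewrite exchange_big /= (bigD1 (Ordinal em)) //= [X in _ + X]big1 ?addr0; last first.
  move=> k; rewrite -val_eqE /= => ke; rewrite -mulr_sumr prim_power_sum ?mulr0 //.
  apply/negP => /dvdnP [c cE]; have := ltn_ord k.
  case: c cE => [|[|c]]; rewrite ?mulSn; lia.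
have -> : (e.+1 + (m.-1 - e) = m)%N by lia.
rewrite (eq_bigr (fun=> y0 ^+ m * u ^+ e)); last first.
  by move=> i _; rewrite exprAC (prim_expr_order zm) expr1n mulr1.
by rewrite sumr_const card_ord mulr_natl.
Qed.

(** With [e = 0] the mean is that of [(x - a) * f x], as in [arc_mean]; other values of [e] extract
    the moments of the residues. *)
Lemma node_mean_pole_sum (m e : nat) (z y0 a : F) (s : seq (F * F)) :
  m.-primitive_root z -> (e < m)%N -> m%:R != 0 :> F ->
  (forall wc, wc \in s -> (wc.2 - a) ^+ m != y0 ^+ m) ->
  m%:R^-1 * \sum_(i < m) (y0 * z ^+ i) ^+ e.+1 * pole_sum s (a + y0 * z ^+ i) =
  \sum_(wc <- s) wc.1 * (y0 ^+ m * (wc.2 - a) ^+ e / (y0 ^+ m - (wc.2 - a) ^+ m)).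
Proof.
move=> zm em m0 sm; apply: (mulfI m0); rewrite mulrA mulfV // mul1r.
under eq_bigr do rewrite /pole_sum mulr_sumr.
rewrite exchange_big /= mulr_sumr big_seq [RHS]big_seq; apply: eq_bigr => wc ws.
rewrite mulrCA -(node_sum zm em (sm wc ws)) mulr_sumr; apply: eq_bigr => i _.
by rewrite opprB [a + _]addrC addrA mulrCA.
Qed.

End NodeSums.

(** * Limits of the node weights as the number of nodes grows *)

Section Vanishing.
Variables (R : realType) (F : fieldType) (v : F -> R).
Hypothesis vP : ultrametric_abs v.

Definition vanishing (u : nat -> F) : Prop :=
  forall e : R, 0 < e -> exists N, forall m, (N <= m)%N -> v (u m) <= e.

Lemma vanishing_sum (I : eqType) (s : seq I) (f : I -> nat -> F) :
  (forall i, i \in s -> vanishing (f i)) -> vanishing (fun m => \sum_(i <- s) f i m).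
Proof.
elim: s => [|i s IH] h e e0.
  by exists 0%N => m _; rewrite big_nil (uabs0 vP) ltW.
have [|N1 H1] := h i _ e e0; first by rewrite mem_head.
have [|N2 H2] := IH _ e e0; first by move=> j js; apply: h; rewrite inE js orbT.
exists (N1 + N2)%N => m Nm; rewrite big_cons; apply: (uabsD_le vP).
  by apply: H1; lia.
by apply: H2; lia.
Qed.

Lemma vanishing_geom c x : v x < 1 -> vanishing (fun m => c * x ^+ m).
Proof.
move=> x1 e e0; have [c0|c0] := eqVneq c 0.
  by exists 0%N => m _; rewrite c0 mul0r (uabs0 vP) ltW.
have vc : 0 < v c by rewrite (uabs_gt0 vP).
have [|N HN] := @exprn_small R (v x) (e / v c) _ (divr_gt0 e0 vc).
  by rewrite (uabs_ge0 vP).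
by exists N => m Nm; rewrite (uabsM vP) (uabsX vP) mulrC -ler_pdivlMr // ltW // HN.
Qed.

Lemma vanishing_le (u w : nat -> F) N0 : (forall m, (N0 <= m)%N -> v (u m) <= v (w m)) ->
  vanishing w -> vanishing u.
Proof.
move=> uw hw e e0; have [N HN] := hw e e0; exists (N0 + N)%N => m Nm.
by apply: le_trans (uw m _) (HN m _); lia.
Qed.

Lemma vanishing_bound (g : nat -> F) x B : vanishing (fun m => x - g m) ->
  (forall N, exists2 m, (N <= m)%N & v (g m) <= B) -> v x <= B.
Proof.
move=> hg gB; apply: (uabs_limit_le vP) => e e0; have [N HN] := hg e e0.
by have [m Nm gm] := gB N; exists (g m) => //; apply: HN.
Qed.

Lemma vanishing_cond_sum (I : eqType) (s : seq I) (P : pred I) (f : I -> F) (g : nat -> I -> F) :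
  (forall i, i \in s -> vanishing (fun m => (if P i then f i else 0) - g m i)) ->
  vanishing (fun m => \sum_(i <- s | P i) f i - \sum_(i <- s) g m i).
Proof.
move=> h; have := @vanishing_sum I s (fun i m => (if P i then f i else 0) - g m i) h.
move=> H e e0; have [N HN] := H e e0; exists N => m /HN.
by rewrite sumrB -big_mkcond.
Qed.

(* These are the weights of the poles in [node_mean_pole_sum]: for large [m] only
   the poles inside the circle of nodes contribute. *)
Lemma vanishing_inside (w u y : F) (e : nat) : v u < v y ->
  vanishing (fun m => w * u ^+ e - w * (y ^+ m * u ^+ e / (y ^+ m - u ^+ m))).
Proof.
move=> uy; have y0 : y != 0 by rewrite -(uabs_gt0 vP) (le_lt_trans (uabs_ge0 vP u) uy).
have t1 : v (u / y) < 1.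
  by rewrite (uabsM vP) (uabsV vP) ltr_pdivrMr ?mul1r // (uabs_gt0 vP).
apply: (@vanishing_le _ _ 1 _ (vanishing_geom (w * u ^+ e) t1)) => m m0.
have tm : v ((u / y) ^+ m) < 1 by apply: (uabsX_lt1 vP).
have d1 : v (1 - (u / y) ^+ m) = 1.
  by rewrite (uabsD_eq vP) (uabs1 vP) // (uabsN vP).
have d0 : 1 - (u / y) ^+ m != 0 by rewrite -(uabs_gt0 vP) d1.
have yd : y ^+ m - u ^+ m = y ^+ m * (1 - (u / y) ^+ m).
  by rewrite expr_div_n mulrBr mulr1 mulrC divfK // expf_neq0.
set t := (u / y) ^+ m in tm d1 d0 yd *.
have -> : w * u ^+ e - w * (y ^+ m * u ^+ e / (y ^+ m - u ^+ m)) =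
   (w * u ^+ e * t) * (- (1 - t)^-1).
  by rewrite yd; field; rewrite ?d0 ?y0 ?u0 ?expf_neq0.
by rewrite (uabsM vP) (uabsN vP) (uabsV vP) d1 invr1 mulr1.
Qed.

Lemma vanishing_outside (w u y : F) (e : nat) : y != 0 -> v y < v u ->
  vanishing (fun m => 0 - w * (y ^+ m * u ^+ e / (y ^+ m - u ^+ m))).
Proof.
move=> y0 yu; have u0 : u != 0 by rewrite -(uabs_gt0 vP) (le_lt_trans (uabs_ge0 vP y) yu).
have t1 : v (y / u) < 1.
  by rewrite (uabsM vP) (uabsV vP) ltr_pdivrMr ?mul1r // (uabs_gt0 vP).
apply: (@vanishing_le _ _ 1 _ (vanishing_geom (w * u ^+ e) t1)) => m m0.
have tm : v ((y / u) ^+ m) < 1 by apply: (uabsX_lt1 vP).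
have d1 : v (1 - (y / u) ^+ m) = 1.
  by rewrite (uabsD_eq vP) (uabs1 vP) // (uabsN vP).
have d0 : 1 - (y / u) ^+ m != 0 by rewrite -(uabs_gt0 vP) d1.
have yE : y ^+ m = (y / u) ^+ m * u ^+ m by rewrite expr_div_n divfK // expf_neq0.
set t := (y / u) ^+ m in tm d1 d0 yE *.
have -> : 0 - w * (y ^+ m * u ^+ e / (y ^+ m - u ^+ m)) =
   (w * u ^+ e * t) * (1 - t)^-1.
  have -> : y ^+ m - u ^+ m = - ((1 - t) * u ^+ m) by rewrite yE; ring.
  by rewrite yE; field; rewrite d0 oppr_eq0 mulf_neq0 ?d0 ?expf_neq0.
by rewrite (uabsM vP) (uabsV vP) d1 invr1 mulr1.
Qed.

End Vanishing.

(* Bounds on the weighted moments [sum w u^l g(c)] are stable under the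
   operations building [g] from functions with integral coefficients in [u]. *)
Section MomentBounds.
Variables (R : realType) (F : fieldType) (v : F -> R).
Hypothesis vP : ultrametric_abs v.
Variables (s : seq (F * F)) (P : pred (F * F)) (u : F -> F) (B : R).

(** All powers of [u] are bounded at once, so that multiplication by [u] merely shifts [l]. *)
Definition moments_le (g : F -> F) : Prop :=
  forall l, v (\sum_(wc <- s | P wc) wc.1 * (u wc.2 ^+ l * g wc.2)) <= B.

Lemma eq_moments_le g h : (forall wc, wc \in s -> P wc -> g wc.2 = h wc.2) ->
  moments_le g -> moments_le h.
Proof.
move=> gh gT l; rewrite big_seq_cond.
rewrite (eq_bigr (fun wc => wc.1 * (u wc.2 ^+ l * g wc.2))) -?big_seq_cond //.
by move=> wc /andP[ws Pw]; rewrite gh.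
Qed.

Lemma moments_le_var g : moments_le g -> moments_le (fun c => u c * g c).
Proof.
by move=> gT l; have := gT l.+1; under eq_bigr do rewrite exprSr -mulrA.
Qed.

Lemma moments_leZ k g : v k <= 1 -> moments_le g -> moments_le (fun c => k * g c).
Proof.
move=> k1 gT l; under eq_bigr do rewrite (mulrCA _ k) (mulrCA _ k); rewrite -mulr_sumr.
by rewrite (uabsM vP); apply: le_trans (gT l); rewrite ler_piMl ?uabs_ge0.
Qed.

Lemma moments_leD g h : moments_le g -> moments_le h -> moments_le (fun c => g c + h c).
Proof.
move=> gT hT l; under eq_bigr do rewrite !mulrDr; rewrite big_split.
exact: (uabsD_le vP).
Qed.

(** The multipliers form a ring that contains [u] and the integral constants. *)
Definition multiplier (d : F -> F) : Prop :=
  forall g, moments_le g -> moments_le (fun c => d c * g c).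

Lemma multiplier_var : multiplier u.
Proof. exact: moments_le_var. Qed.

Lemma multiplierC k : v k <= 1 -> multiplier (fun=> k).
Proof. by move=> k1 g; apply: moments_leZ. Qed.

Lemma multiplierD d d' : multiplier d -> multiplier d' -> multiplier (fun c => d c + d' c).
Proof.
move=> dM d'M g gT; apply: eq_moments_le (moments_leD (dM _ gT) (d'M _ gT)) => wc _ _.
by rewrite mulrDl.
Qed.

Lemma multiplierM d d' : multiplier d -> multiplier d' -> multiplier (fun c => d c * d' c).
Proof.
move=> dM d'M g gT; apply: eq_moments_le (dM _ (d'M _ gT)) => wc _ _.
by rewrite mulrA.
Qed.

Lemma multiplierX d n : multiplier d -> multiplier (fun c => d c ^+ n).
Proof.
move=> dM; elim: n => [|n IH] g gT.
  by apply: eq_moments_le gT => wc _ _; rewrite expr0 mul1r.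
by apply: eq_moments_le (multiplierM dM IH gT) => wc _ _; rewrite exprS.
Qed.

(** Partial sums of the geometric series are multipliers, and the bound passes to the limit over the
    finitely many poles. The rate of convergence does not enter [B]; this is why later bounds are
    uniform in the exponents [p ^ n]. *)
Lemma multiplier_geom d : multiplier d ->
  (forall wc, wc \in s -> P wc -> v (d wc.2) < 1) -> multiplier (fun c => (1 - d c)^-1).
Proof.
move=> dM d1 g gT l.
have B0 : 0 <= B by apply: le_trans (gT 0%N); apply: uabs_ge0.
pose part E c := (\sum_(e < E) d c ^+ e) * g c.
have partT E : moments_le (part E).
  elim: E => [|E IH].
    move=> l'; rewrite big1 ?(uabs0 vP) // => wc _.
    by rewrite /part big_ord0 mul0r !mulr0.
  apply: eq_moments_le (moments_leD IH (multiplierX E dM gT)) => wc _ _.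
  by rewrite /part big_ord_recr /= mulrDl.
apply: (@vanishing_bound R F v vP
  (fun E => \sum_(wc <- s | P wc) wc.1 * (u wc.2 ^+ l * part E wc.2))); last first.
  by move=> N; exists N => //; apply: partT.
have := @vanishing_cond_sum R F v vP _ s P
  (fun wc => wc.1 * (u wc.2 ^+ l * ((1 - d wc.2)^-1 * g wc.2)))
  (fun E wc => if P wc then wc.1 * (u wc.2 ^+ l * part E wc.2) else 0).
move=> H; apply: (vanishing_le (N0 := 0) _ (H _)) => [E _|wc ws].
  by rewrite [X in _ - X]big_mkcond.
case: ifP => Pw; last first.
  by move=> e e0; exists 0%N => m _; rewrite subrr (uabs0 vP) ltW.
have d1w := d1 wc ws Pw; set x := d wc.2 in d1w *.
have x1 : 1 - x != 0 by rewrite subr_eq0; apply/eqP => x1; move: d1w; rewrite -x1 (uabs1 vP) ltxx.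
apply: (vanishing_le (N0 := 0) _ (vanishing_geom vP (wc.1 * u wc.2 ^+ l * (1 - x)^-1 * g wc.2) d1w)).
move=> E _; rewrite le_eqVlt; apply/orP; left; apply/eqP; congr v.
have -> : part E wc.2 = (1 - x ^+ E) / (1 - x) * g wc.2.
  rewrite /part -/x; congr (_ * _); apply: (mulfI x1); rewrite -[RHS]mulrC divfK //.
  by rewrite -opprB -[RHS]opprB mulNr -subrX1.
by field.
Qed.

End MomentBounds.

(** * Cauchy estimates on a circle around a hole *)

Section Circles.
Variables (R : realType) (p : nat) (C : Cp_tower R p).
Hypothesis p_prime : prime p.

Local Notation abs := (@Cp_abs R p C).
Let vC := Cp_absP C.

Lemma Cp_abs_coprime n : ~~ (p %| n)%N -> abs n%:R = 1.
Proof. by move=> pn; rewrite Cp_abs_nat padic_abs_coprime. Qed.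

Lemma prim_root_abs (m : nat) (z : C) : m.-primitive_root z -> abs z = 1.
Proof.
move=> zm; apply: (pexpIrn (n := m)); rewrite ?nnegrE ?uabs_ge0 ?ler01 //.
  exact: prim_order_gt0 zm.
by rewrite -(uabsX vC) (prim_expr_order zm) (uabs1 vC) expr1n.
Qed.

Lemma node_mean_le (m e : nat) (z y a : C) (s : seq (C * C)) (eps : R) :
  m.-primitive_root z -> (e < m)%N -> ~~ (p %| m)%N ->
  (forall wc, wc \in s -> (wc.2 - a) ^+ m != y ^+ m) ->
  (forall i, abs (pole_sum s (a + y * z ^+ i)) <= eps) ->
  abs (\sum_(wc <- s) wc.1 * (y ^+ m * (wc.2 - a) ^+ e / (y ^+ m - (wc.2 - a) ^+ m)))
    <= abs y ^+ e.+1 * eps.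
Proof.
move=> zm em pm sm se; have m1 := Cp_abs_coprime pm.
have m0 : m%:R != 0 :> C by rewrite -(uabs_gt0 vC) m1.
rewrite -(node_mean_pole_sum zm em m0 sm) (uabsM vC) (uabsV vC) m1 invr1 mul1r.
have e0 : 0 <= eps by apply: le_trans (se 0%N); apply: uabs_ge0.
apply: (uabs_sum_le vC) => [|i _]; first by rewrite mulr_ge0 ?exprn_ge0 ?uabs_ge0.
have z1 := prim_root_abs zm.
by rewrite (uabsM vC) !(uabsX vC) (uabsM vC) (uabsX vC) z1 expr1n mulr1
  (ler_wpM2l _ (se i)) // exprn_ge0 // uabs_ge0.
Qed.

(** This is Cauchy's estimate for the coefficient of [(x - a) ^- l.+1] in the Laurent expansion on
    the circle. As the number [m] of nodes grows, the poles beyond the circle drop out of the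
    mean. *)
Lemma hole_moments (a y : C) (s : seq (C * C)) (eps : R) (l : nat) : y != 0 ->
  (forall wc, wc \in s -> abs (wc.2 - a) < abs y \/ abs y < abs (wc.2 - a)) ->
  (forall x, abs (x - a) = abs y -> abs (pole_sum s x) <= eps) ->
  abs (\sum_(wc <- s | abs (wc.2 - a) < abs y) wc.1 * (wc.2 - a) ^+ l) <=
    abs y ^+ l.+1 * eps.
Proof.
move=> y0 sy se.
apply: (@vanishing_bound R C abs vC (fun m => \sum_(wc <- s)
  wc.1 * (y ^+ m * (wc.2 - a) ^+ l / (y ^+ m - (wc.2 - a) ^+ m)))).
  apply: (@vanishing_cond_sum R C abs vC _ s (fun wc => abs (wc.2 - a) < abs y)
    (fun wc => wc.1 * (wc.2 - a) ^+ l)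
    (fun m wc => wc.1 * (y ^+ m * (wc.2 - a) ^+ l / (y ^+ m - (wc.2 - a) ^+ m)))).
  move=> wc ws /=; case: ifP => h; first exact: (vanishing_inside vC).
  by apply: (vanishing_outside vC) => //; case: (sy wc ws) => //; rewrite h.
(* [m] is 1 modulo [p], hence prime to [p], and exceeds both [N] and [l]. *)
move=> N; pose m := (p * (N + l).+1 + 1)%N.
have p0 := prime_gt0 p_prime.
have mN : (N + l < m)%N by rewrite /m; have := leq_pmull (N + l).+1 p0; lia.
exists m; first lia.
have [z zm] : exists z : C, m.-primitive_root z.
  by apply: Cp_prim_root => //; lia.
apply: (node_mean_le zm); first by lia.
- by rewrite /m dvdn_addr ?dvdn_mulr // dvdn1; move: p_prime; case: eqP => // ->.
- move=> wc ws; apply/eqP => /(congr1 abs); rewrite !(uabsX vC) => /eqP.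
  rewrite (eqrXn2 _ (uabs_ge0 vC _) (uabs_ge0 vC _)); last by lia.
  by case: (sy wc ws) => h; [rewrite lt_eqF|rewrite gt_eqF].
move=> i; apply: se; rewrite addrAC subrr add0r (uabsM vC) (uabsX vC).
by rewrite (prim_root_abs zm) expr1n mulr1.
Qed.

Lemma arc_mean_nodes (a b : C) (f : C -> C) (n : nat) (z : C) :
  (p ^ n)%N.-primitive_root z ->
  arc_mean a b f n =
  (p ^ n)%:R^-1 * \sum_(i < p ^ n) ((b - a) * z ^+ i) ^+ 1 * f (a + (b - a) * z ^+ i).
Proof.
move=> zn; rewrite /arc_mean -natrX; congr (_ * _).
have -> : [set z : C | (p ^ n)%N.-unity_root z] =
    [set` [seq z ^+ i | i <- index_iota 0 (p ^ n)]].
  apply/seteqP; split=> y /=.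
    move=> /unity_rootP /(prim_rootP zn) [i ->].
    by apply/mapP; exists (i : nat) => //; rewrite mem_index_iota /= ltn_ord.
  case/mapP => i _ ->; apply/unity_rootP.
  by rewrite exprAC (prim_expr_order zn) expr1n.
rewrite -fsbig_seq ?big_map ?big_mkord; last first.
  rewrite map_inj_in_uniq ?iota_uniq // => i j; rewrite !mem_index_iota => /andP[_ ib] /andP[_ jb].
  by move/eqP; rewrite (eq_prim_root_expr zn) !modn_small // => /eqP.
by apply: eq_bigr => i _; rewrite /arc_node addrAC subrr add0r expr1.
Qed.

End Circles.

(** * The large circle: uniform bound and limit of the arc means *)

Section BigCircle.
Variables (R : realType) (p : nat) (C : Cp_tower R p).
Hypotheses (p_prime : prime p) (p_odd : odd p).

Local Notation abs := (@Cp_abs R p C).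
Let vC := Cp_absP C.
Let vp := Cp_p_lt1 C p_prime.

Variables (a b : C) (M : nat) (x y z : 'I_M -> C) (lam : nat).

Local Notation rad := (abs (b - a)).
Local Notation t c := ((c - a) / (b - a)).

Hypotheses (ab : b - a != 0) (lam0 : (0 < lam)%N).
Hypotheses (xa : forall i, abs (x i - a) <= rad) (bx : forall i, abs (b - x i) = rad).
Hypotheses (y0 : forall i, y i != 0) (yrad : forall i, abs (y i) <= rad).
Hypothesis sep : forall i j, i != j -> abs (y i) < abs (x i - x j).
Hypotheses (tz : forall i, abs (t (x i) - z i) < 1).
Hypotheses (zlam : forall i, z i ^+ (p ^ lam) = z i).

(** The holes get the radii [abs (y i)] of the small circles, so that [perforated] still contains
    these circles as well as the nodes of the large one. *)
Definition outer (wc : C * C) := rad < abs (wc.2 - a).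
Definition hole (i : 'I_M) (wc : C * C) := abs (wc.2 - x i) < abs (y i).
Definition well_placed (s : seq (C * C)) :=
  forall wc, wc \in s -> outer wc \/ exists i, hole i wc.
Definition perforated (c : C) :=
  abs (c - a) <= rad /\ forall i, abs (y i) <= abs (c - x i).

Let rad0 : 0 < rad. Proof. by rewrite (uabs_gt0 vC). Qed.

Let abs_t c : abs (t c) = abs (c - a) / rad.
Proof. by rewrite (uabsM vC) (uabsV vC). Qed.

Let tx1 i : abs (t (x i)) <= 1.
Proof. by rewrite abs_t ler_pdivrMr ?mul1r. Qed.

Let z1 i : abs (z i) <= 1.
Proof.
rewrite -[z i](subKr (t (x i))); apply: (uabsB_le vC) => //.
by apply: ltW; apply: tz.
Qed.

Lemma hole_inner i wc : hole i wc -> abs (wc.2 - a) <= rad.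
Proof.
move=> h; apply: (uabs_tr_le vC (z := x i)) => //.
exact: le_trans (ltW h) (yrad i).
Qed.

Lemma hole_not_outer i wc : hole i wc -> outer wc = false.
Proof. by move=> h; rewrite /outer ltNge (hole_inner h). Qed.

Lemma hole_far i j wc : hole j wc -> i != j -> abs (y i) < abs (wc.2 - x i).
Proof.
rewrite /hole => h ij; have ji : j != i by rewrite eq_sym.
have -> : wc.2 - x i = - ((x i - x j) - (wc.2 - x j)) by ring.
rewrite (uabsN vC) (uabsD_eq vC) ?sep // (uabsN vC).
by apply: lt_trans h _; rewrite (uabs_sub vC) sep.
Qed.

Lemma hole_uniq i j wc : hole i wc -> hole j wc -> i = j.
Proof.
move=> hi hj; apply/eqP; apply: contraTT hi => ij.
by rewrite /hole -leNgt ltW // (hole_far hj).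
Qed.

(** Strict separation on both sides: no pole lies on a small circle, as [hole_moments] demands. *)
Lemma hole_dichotomy i s wc : well_placed s -> wc \in s ->
  hole i wc \/ abs (y i) < abs (wc.2 - x i).
Proof.
move=> sP /sP [ho|[j hj]].
  right; have -> : wc.2 - x i = (wc.2 - a) - (x i - a) by ring.
  rewrite (uabsD_eq vC); first by apply: le_lt_trans (yrad i) ho.
  by rewrite (uabsN vC); apply: le_lt_trans (xa i) ho.
have [->|ij] := eqVneq i j; first by left.
by right; apply: hole_far hj ij.
Qed.

Lemma circle_perforated i c : abs (c - x i) = abs (y i) -> perforated c.
Proof.
move=> ci; split.
  by apply: (uabs_tr_le vC (z := x i)) => //; rewrite ci.
move=> j; have [->|ji] := eqVneq j i; first by rewrite ci.
have -> : c - x j = (x i - x j) + (c - x i) by ring.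
have ij : i != j by rewrite eq_sym.
rewrite (uabsD_eq vC); last by rewrite ci sep.
by rewrite (uabs_sub vC) ltW // sep.
Qed.

Lemma split_holes s (g : C * C -> C) : well_placed s ->
  \sum_(wc <- s) g wc =
  \sum_(wc <- s | outer wc) g wc + \sum_i \sum_(wc <- s | hole i wc) g wc.
Proof.
move=> sP; rewrite (exchange_big_dep xpredT) //= [X in _ = X + _]big_mkcond -big_split /=.
rewrite big_seq [RHS]big_seq; apply: eq_bigr => wc ws.
case: ifP => ho.
  rewrite big_pred0 ?addr0 // => i; apply/negP => /hole_not_outer.
  by rewrite ho.
have [|[i hi]] := sP wc ws; first by rewrite ho.
rewrite (big_pred1 i) ?add0r // => j /=; apply/idP/eqP => [hj|->//].
exact: hole_uniq hj hi.
Qed.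

(** The condition on [b] says that [t (x i)] is not in the residue class of 1, and no [p ^ n]-th
    power can bring it there. *)
Lemma node_const1 i n : abs (1 - t (x i) ^+ (p ^ n)) = 1.
Proof.
have t1 : abs (1 - t (x i)) = 1.
  have -> : 1 - t (x i) = (b - x i) / (b - a) by field.
  by rewrite (uabsM vC) (uabsV vC) bx divff // gt_eqF.
apply/eqP; rewrite eq_le (uabsB_le vC) ?(uabs1 vC) ?(uabsX_le1 vC) //= leNgt.
apply/negP; rewrite (uabs_sub vC) => /(uabs_root_stepn vC p_prime vp (tx1 i)).
by rewrite (uabs_sub vC) t1 ltxx.
Qed.

(* Exponents [m] prime to [p] with [t(x i)^m] congruent to [0] or [1], so that
   the roots of [-1] of order [m] avoid the residue classes of the holes. *)
Definition node_exp (k : nat) := ((p ^ lam).-1 * (2 * p * k + 1))%N.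

Let plam : (0 < (p ^ lam).-1)%N.
Proof.
have h : (1 < p ^ lam)%N by rewrite -(exp1n lam) ltn_exp2r // prime_gt1.
by lia.
Qed.

(** Modulo [p] the first factor is [-1]; the second, which lets the exponent grow with [k], is 1. *)
Lemma node_exp_coprime k : ~~ (p %| node_exp k)%N.
Proof.
have p1 := prime_gt1 p_prime.
rewrite /node_exp Euclid_dvdM // negb_or; apply/andP; split.
  apply/negP => h; have : (p %| (p ^ lam).-1 + 1)%N.
    by rewrite addn1 prednK ?expn_gt0 ?prime_gt0 // dvdn_exp.
  by rewrite dvdn_addr // dvdn1 gtn_eqF.
by rewrite dvdn_addr ?dvdn1 ?gtn_eqF // -mulnA mulnCA dvdn_mulr.
Qed.

Lemma node_exp_gt k : (k < node_exp k)%N.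
Proof.
have p0 := prime_gt0 p_prime.
apply: leq_trans (leq_pmull _ plam).
have := leq_pmull k p0; rewrite -mulnA; lia.
Qed.

(** Modulo the maximal ideal the value is [-1] or [-2], both units since [p] is odd. *)
Lemma node_constN1 i k : abs (-1 - t (x i) ^+ node_exp k) = 1.
Proof.
have m0 : (0 < node_exp k)%N by apply: leq_ltn_trans (node_exp_gt k).
rewrite -opprD (uabsN vC).
have [z0|z0] := eqVneq (z i) 0.
  rewrite (uabsD_eq vC) (uabs1 vC) // (uabsX_lt1 vC) //.
  by have := tz i; rewrite z0 subr0.
have zm : z i ^+ node_exp k = 1.
  rewrite /node_exp exprM (_ : z i ^+ (p ^ lam).-1 = 1) ?expr1n //.
  by apply: (mulfI z0); rewrite -exprS prednK ?expn_gt0 ?prime_gt0 // zlam mulr1.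
have -> : 1 + t (x i) ^+ node_exp k = 2%:R + (t (x i) ^+ node_exp k - z i ^+ node_exp k).
  by rewrite zm; ring.
have two : abs 2%:R = 1.
  apply: Cp_abs_coprime => //; rewrite dvdn_prime2 //; apply/eqP => p2.
  by move: p_odd; rewrite p2.
rewrite (uabsD_eq vC) two //.
by apply: le_lt_trans (tz i); apply: (uabsXB_le vC).
Qed.

Section Bounds.
Variables (s : seq (C * C)) (eps : R).
Hypotheses (sP : well_placed s) (eps0 : 0 <= eps).
Hypothesis s_le : forall c, perforated c -> abs (pole_sum s c) <= eps.

(** Stated for a unit [th] because it serves twice: with [th = 1], [m = p ^ n] for the arc means and
    with [th = -1], [m = node_exp k] for the outer moments. *)
Lemma hole_weight_le i e m (th : C) : abs th = 1 -> abs (th - t (x i) ^+ m) = 1 ->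
  abs (\sum_(wc <- s | hole i wc) wc.1 * (th * t wc.2 ^+ e / (th - t wc.2 ^+ m)))
    <= rad * eps.
Proof.
move=> th1; set tau := t (x i); set be := th - tau ^+ m => be1.
have be0 : be != 0 by rewrite -(uabs_gt0 vC) be1.
pose u c := (c - x i) / (b - a).
have tE c : t c = tau + u c by rewrite /tau /u; field.
pose T := moments_le abs s (hole i) u (rad * eps).
have T1 : T (fun=> 1).
  move=> l; rewrite (eq_bigr (fun wc => (b - a) ^- l * (wc.1 * (wc.2 - x i) ^+ l))); last first.
    by move=> wc _; rewrite mulr1 /u expr_div_n mulrA mulrC.
  rewrite -mulr_sumr (uabsM vC) (uabsV vC) (uabsX vC) mulrC ler_pdivrMr ?exprn_gt0 //.
  apply: le_trans (hole_moments p_prime (eps := eps) l (y0 i) _ _) _.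
  - by move=> wc ws; apply: hole_dichotomy sP ws.
  - by move=> c ci; apply: s_le; apply: circle_perforated ci.
  rewrite mulrAC -exprS ler_wpM2r // lerXn2r ?nnegrE ?uabs_ge0 //.
have Mt : multiplier abs s (hole i) u (rad * eps) (fun c => t c).
  move=> g gT; have := multiplierD vC (multiplierC vC (tx1 i)) (@multiplier_var R C abs s (hole i) u _) gT.
  by move/eq_moments_le; apply=> wc _ _; rewrite (tE wc.2).
(* [th - t c ^+ m] is [be * (1 - d c)]. Inside the hole [t c] is in the residue class of [t (x i)],
   so the inverse of the second factor is a geometric series. *)
pose d c := be^-1 * (t c ^+ m + - tau ^+ m).
have be1' : abs be^-1 <= 1 by rewrite (uabsV vC) be1 invr1.
have Md : multiplier abs s (hole i) u (rad * eps) d.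
  apply: (multiplierM (multiplierC vC be1')); apply: (multiplierD vC).
    exact: multiplierX.
  by apply: (multiplierC vC); rewrite (uabsN vC) (uabsX_le1 vC) // tx1.
have d1 wc : wc \in s -> hole i wc -> abs (d wc.2) < 1.
  move=> ws h; rewrite /d (uabsM vC) (uabsV vC) be1 invr1 mul1r.
  have t1 : abs (t wc.2) <= 1 by rewrite abs_t ler_pdivrMr // mul1r (hole_inner h).
  apply: le_lt_trans (uabsXB_le vC m t1 (tx1 i)) _.
  have -> : t wc.2 - t (x i) = (wc.2 - x i) / (b - a) by field.
  rewrite (uabsM vC) (uabsV vC) ltr_pdivrMr // mul1r.
  exact: lt_le_trans h (yrad i).
have Tall := multiplierM (multiplierM (multiplierC vC (_ : abs (th / be) <= 1))
  (multiplierX e Mt)) (multiplier_geom vC Md d1) T1.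
have := Tall _ 0%N; rewrite (uabsM vC) th1 mul1r => /(_ be1').
rewrite (_ : \sum_(wc <- s | hole i wc) _ =
  \sum_(wc <- s | hole i wc) wc.1 * (th * t wc.2 ^+ e / (th - t wc.2 ^+ m))) //.
rewrite big_seq_cond [RHS]big_seq_cond; apply: eq_bigr => wc /andP[ws h].
rewrite expr0 mul1r mulr1; congr (_ * _).
have -> : th - t wc.2 ^+ m = be * (1 - d wc.2).
  by rewrite /d mulrBr mulr1 mulVKf // /be; ring.
by rewrite invfM -!mulrA; congr (_ * _); rewrite mulrCA.
Qed.

(** Up to scaling these are Taylor coefficients at [a] of the part of the sum with poles outside.
    The weight [t ^+ (m - l) / (1 + t ^+ m)] tends to [t ^- l] on the outer poles; their share is
    the node mean over all poles minus the shares of the holes, each bounded already. *)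
Lemma outer_moments l : (0 < l)%N ->
  abs (\sum_(wc <- s | outer wc) wc.1 * (t wc.2)^-1 ^+ l) <= rad * eps.
Proof.
move=> l0.
pose wt k wc : C := wc.1 * (-1 * t wc.2 ^+ (node_exp k - l) / (-1 - t wc.2 ^+ node_exp k)).
have tout wc : outer wc -> 1 < abs (t wc.2) by move=> ho; rewrite abs_t ltr_pdivlMr ?mul1r.
apply: (@vanishing_bound R C abs vC (fun k => \sum_(wc <- s | outer wc) wt k wc)).
  have := @vanishing_cond_sum R C abs vC _ s outer
     (fun wc => wc.1 * (t wc.2)^-1 ^+ l) (fun k wc => if outer wc then wt k wc else 0).
  move=> H; apply: (vanishing_le (N0 := 0) _ (H _)) => [k _|wc ws].
    by rewrite [X in _ - X]big_mkcond.
  case: ifP => ho; last first.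
    by move=> e e0; exists 0%N => k _; rewrite subrr (uabs0 vC) ltW.
  have t1 := tout wc ho; rewrite /wt; set T := t wc.2 in t1 *.
  have T0 : T != 0 by rewrite -(uabs_gt0 vC) (lt_trans ltr01).
  have iT1 : abs T^-1 < 1 by rewrite (uabsV vC) invf_lt1 // (lt_trans ltr01).
  apply: (vanishing_le (N0 := l) _ (vanishing_geom vC (wc.1 * T^-1 ^+ l) iT1)) => k lk.
  have km := node_exp_gt k; set m := node_exp k in km *.
  have Tm1 : abs 1 < abs (T ^+ m) by rewrite (uabs1 vC) (uabsX vC) exprn_egt1 // gtn_eqF // (leq_ltn_trans _ km).
  have Td : abs (T ^+ m + 1) = abs (T ^+ m) by apply: (uabsD_eq vC).
  have Td0 : T ^+ m + 1 != 0 by rewrite -(uabs_gt0 vC) Td (lt_trans _ Tm1) // (uabs1 vC).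
  have -> : T ^+ (m - l) = T ^+ m * T^-1 ^+ l.
    by rewrite exprVn expfB_cond // (negPf T0) (leq_trans lk) // ltnW.
  have -> : -1 - T ^+ m = - (T ^+ m + 1) by ring.
  set q := T^-1 ^+ l; set Tm := T ^+ m in Tm1 Td Td0 *.
  have -> : wc.1 * q - wc.1 * (-1 * (Tm * q) / - (Tm + 1)) = wc.1 * q * (Tm + 1)^-1.
    by field; rewrite ?oppr_eq0 ?Td0.
  rewrite (uabsM vC) [leRHS](uabsM vC) (uabsV vC) Td ler_wpM2l ?uabs_ge0 //.
  rewrite -(uabsV vC) /Tm -exprVn !(uabsX vC) ler_wiXn2l ?uabs_ge0 //; first exact: ltW.
  exact: ltnW.
move=> N; exists (N + l)%N; first exact: leq_addr.
(* Adding [l] makes the truncated difference [node_exp k - l] a true one. *)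
set k := (N + l)%N; have km : (l < node_exp k)%N.
  by apply: leq_ltn_trans (node_exp_gt k); apply: leq_addl.
have tot : abs (\sum_(wc <- s) wt k wc) <= rad * eps; last first.
  have := split_holes (wt k) sP => /esym /eqP; rewrite eq_sym -subr_eq => /eqP <-.
  apply: (uabsB_le vC) => //; apply: (uabs_sum_le vC) => [|i _].
    by rewrite mulr_ge0 // ltW.
  by apply: hole_weight_le; rewrite ?(uabsN vC) ?(uabs1 vC) // node_constN1.
rewrite {}/wt; set m := node_exp k in km *; set e := (m - l)%N.
have m0 : (0 < m)%N by apply: leq_ltn_trans km.
have pm : ~~ (p %| m)%N by apply: node_exp_coprime.
have [y1] : exists y1 : C, root ('X^m - (-1)%:P) y1.
  by apply: (Cp_root_exists (C := C)); rewrite ?monicXnsubC ?size_XnsubC.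
rewrite /root !hornerE subr_eq0 => /eqP y1m.
have [w wm] : exists w : C, m.-primitive_root w by apply: Cp_prim_root.
have y1w i : (y1 * w ^+ i) ^+ m = -1.
  by rewrite exprMn y1m exprAC (prim_expr_order wm) expr1n mulr1.
have aw i : abs (y1 * w ^+ i) = 1.
  apply: (pexpIrn m0); rewrite ?nnegrE ?uabs_ge0 ?ler01 //.
  by rewrite -(uabsX vC) y1w (uabsN vC) (uabs1 vC) expr1n.
have ay1 : abs y1 = 1 by have := aw 0%N; rewrite expr0 mulr1.
have tm wc : wc \in s -> t wc.2 ^+ m != -1.
  move=> ws; apply/eqP => tE; have [ho|[i h]] := sP ws.
    have : 1 < abs (t wc.2 ^+ m) by rewrite (uabsX vC) exprn_egt1 ?tout // gtn_eqF.
    by rewrite tE (uabsN vC) (uabs1 vC) ltxx.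
  have t1 : abs (t wc.2) <= 1 by rewrite abs_t ler_pdivrMr // mul1r (hole_inner h).
  have := uabsXB_le vC m t1 (tx1 i); rewrite tE node_constN1 leNgt => /negP; apply.
  have -> : t wc.2 - t (x i) = (wc.2 - x i) / (b - a) by field.
  rewrite (uabsM vC) (uabsV vC) ltr_pdivrMr // mul1r.
  exact: lt_le_trans h (yrad i).
have em : (e < m)%N by rewrite /e -subn_gt0 subKn // ltnW.
have uE c : c - a = (b - a) * t c by field.
have yE : ((b - a) * y1) ^+ m = - (b - a) ^+ m by rewrite exprMn y1m mulrN1.
have bm : (b - a) ^+ m != 0 by rewrite expf_neq0.
have sum_eq : \sum_(wc <- s) wc.1 * (((b - a) * y1) ^+ m * (wc.2 - a) ^+ e /
   (((b - a) * y1) ^+ m - (wc.2 - a) ^+ m)) =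
   (b - a) ^+ e * \sum_(wc <- s) wc.1 * (-1 * t wc.2 ^+ e / (-1 - t wc.2 ^+ m)).
  rewrite mulr_sumr big_seq [RHS]big_seq; apply: eq_bigr => wc ws.
  rewrite yE; have := tm wc ws; set T := t wc.2 => Tm.
  have -> : wc.2 - a = (b - a) * T by rewrite /T; field.
  have T0 : -1 - T ^+ m != 0 by rewrite subr_eq0 eq_sym.
  have -> : - (b - a) ^+ m - ((b - a) * T) ^+ m = (b - a) ^+ m * (-1 - T ^+ m).
    by rewrite exprMn mulrBr mulrN1.
  rewrite exprMn; set Bm := (b - a) ^+ m in bm *; set Be := (b - a) ^+ e.
  set Te := T ^+ e; set Dm := -1 - T ^+ m in T0 *.
  by field; rewrite T0 bm.
have H : abs ((b - a) ^+ e * \sum_(wc <- s) wc.1 * (-1 * t wc.2 ^+ e / (-1 - t wc.2 ^+ m))) <=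
    rad ^+ e.+1 * eps.
  rewrite -sum_eq -[rad]mulr1 -ay1 -(uabsM vC); apply: (node_mean_le p_prime wm em pm).
    move=> wc ws; rewrite yE (uE wc.2) exprMn; apply: contra (tm wc ws) => /eqP h.
    by apply/eqP; apply: (mulfI bm); rewrite h mulrN1.
  move=> i; apply: s_le; rewrite -mulrA; split.
    by rewrite addrAC subrr add0r (uabsM vC) aw mulr1.
  (* The nodes avoid the holes: the [m]-th powers of [y1 * w ^+ i] and [t (x j)] differ by a unit,
     and for integral elements the difference of powers is no larger than that of the elements. *)
  move=> j; have -> : a + (b - a) * (y1 * w ^+ i) - x j = (b - a) * (y1 * w ^+ i - t (x j)).
    by field.
  apply: le_trans (yrad j) _; rewrite (uabsM vC) ler_peMr ?uabs_ge0 //.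
  rewrite -(node_constN1 j k) -(y1w i); apply: (uabsXB_le vC) => //.
  by rewrite aw.
by move: H; rewrite (uabsM vC) (uabsX vC) exprSr -mulrA ler_pM2l ?exprn_gt0.
Qed.

(** The idle [1 *] and [^+ 0] are the instance [th = 1], [e = 0] of [hole_weight_le]. *)
Lemma arc_weight_le n :
  abs (\sum_(wc <- s) wc.1 * (1 * t wc.2 ^+ 0 / (1 - t wc.2 ^+ (p ^ n)))) <= rad * eps.
Proof.
rewrite (split_holes _ sP); apply: (uabsD_le vC); last first.
  apply: (uabs_sum_le vC) => [|i _]; first by rewrite mulr_ge0 // ltW.
  by apply: hole_weight_le; rewrite ?(uabs1 vC) // node_const1.
pose u c := (t c)^-1.
pose T := moments_le abs s outer u (rad * eps).
(* The family starts at [u], not at 1, because [outer_moments] needs a positive exponent;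
   accordingly [1 / (1 - t ^+ q) = - u ^+ q / (1 - u ^+ q)], with [q = p ^ n], is used with one
   factor [u] split off. *)
have Tu : T u.
  move=> l; have := outer_moments (ltn0Sn l).
  by under eq_bigr do rewrite exprSr.
have tout wc : outer wc -> 1 < abs (t wc.2) by move=> ho; rewrite abs_t ltr_pdivlMr ?mul1r.
have pn : (0 < p ^ n)%N by rewrite expn_gt0 prime_gt0.
have Mu := @multiplier_var R C abs s outer u (rad * eps).
have d1 wc : wc \in s -> outer wc -> abs (u wc.2 ^+ (p ^ n)) < 1.
  move=> _ ho; apply: (uabsX_lt1 vC) => //; rewrite (uabsV vC) invf_lt1 ?tout //.
  exact: lt_trans ltr01 (tout _ ho).
have N1 : abs (-1) <= 1 by rewrite (uabsN vC) (uabs1 vC).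
have := multiplierM (multiplierM (multiplierC vC N1) (multiplierX (p ^ n).-1 Mu))
  (multiplier_geom vC (multiplierX (p ^ n) Mu) d1) Tu 0%N.
rewrite (_ : \sum_(wc <- s | outer wc) _ =
  \sum_(wc <- s | outer wc) wc.1 * (1 * t wc.2 ^+ 0 / (1 - t wc.2 ^+ (p ^ n)))) //.
rewrite big_seq_cond [RHS]big_seq_cond; apply: eq_bigr => wc /andP[ws ho].
rewrite !expr0 !mul1r; congr (_ * _).
rewrite mulrAC -[-1 * _ * _]mulrA -exprSr prednK //.
have := d1 wc ws ho; rewrite /u exprVn => d1'.
have T0 : t wc.2 ^+ (p ^ n) != 0.
  by rewrite expf_neq0 // -(uabs_gt0 vC) (lt_trans ltr01) // tout.
set Tn := t wc.2 ^+ (p ^ n) in d1' T0 *.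
have Tn1 : Tn != 1 by apply/eqP => E; move: d1'; rewrite E invr1 (uabs1 vC) ltxx.
have h1 : 1 - Tn != 0 by rewrite subr_eq0 eq_sym.
have -> : 1 - Tn^-1 = - (1 - Tn) / Tn by field.
by field; rewrite oppr_eq0 T0 h1.
Qed.

Lemma arc_mean_pole_sum n :
  arc_mean a b (pole_sum s) n =
  \sum_(wc <- s) wc.1 * (1 * t wc.2 ^+ 0 / (1 - t wc.2 ^+ (p ^ n))).
Proof.
have pn : (0 < p ^ n)%N by rewrite expn_gt0 prime_gt0.
have [w wn] := Cp_prim_root C p_prime pn.
have uE c : c - a = (b - a) * t c by field.
have bn : (b - a) ^+ (p ^ n) != 0 by rewrite expf_neq0.
have tn wc : wc \in s -> 1 - t wc.2 ^+ (p ^ n) != 0.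
  move=> ws; have [ho|[i h]] := sP ws.
    have t1 : 1 < abs (t wc.2) by rewrite abs_t ltr_pdivlMr ?mul1r.
    rewrite subr_eq0; apply/eqP => /(congr1 abs); rewrite (uabs1 vC) (uabsX vC) => /eqP.
    by rewrite lt_eqF // exprn_egt1 // gtn_eqF.
  have t1 : abs (t wc.2) <= 1 by rewrite abs_t ler_pdivrMr // mul1r (hole_inner h).
  have th : abs (t wc.2 ^+ (p ^ n) - t (x i) ^+ (p ^ n)) < 1.
    apply: le_lt_trans (uabsXB_le vC (p ^ n) t1 (tx1 i)) _.
    have -> : t wc.2 - t (x i) = (wc.2 - x i) / (b - a) by field.
    rewrite (uabsM vC) (uabsV vC) ltr_pdivrMr // mul1r.
    exact: lt_le_trans h (yrad i).
  apply/eqP => t0; move: th; have -> : t wc.2 ^+ (p ^ n) = 1 by apply/esym/eqP; rewrite -subr_eq0 t0.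
  by rewrite node_const1 ltxx.
rewrite (arc_mean_nodes a b _ wn) (node_mean_pole_sum wn) //; last 2 first.
- exact: Cp_nat_neq0.
- move=> wc ws; rewrite (uE wc.2) exprMn; apply: contra (tn wc ws) => /eqP h.
  by rewrite subr_eq0; apply/eqP; apply: (mulfI bn); rewrite h mulr1.
rewrite big_seq [RHS]big_seq; apply: eq_bigr => wc ws.
have := tn wc ws; rewrite !expr0 !mulr1; set T := t wc.2.
have -> : wc.2 - a = (b - a) * T by rewrite /T; field.
rewrite (exprMn (p ^ n) (b - a) T); set Tn := T ^+ _ => T0; congr (_ * _).
have -> : (b - a) ^+ (p ^ n) - (b - a) ^+ (p ^ n) * Tn = (b - a) ^+ (p ^ n) * (1 - Tn) by ring.
by field; rewrite T0 bn.
Qed.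

End Bounds.

Lemma residue_const1 i n : abs (1 - z i ^+ (p ^ n)) = 1.
Proof.
have -> : 1 - z i ^+ (p ^ n) = (1 - t (x i) ^+ (p ^ n)) + (t (x i) ^+ (p ^ n) - z i ^+ (p ^ n)) by ring.
rewrite (uabsD_eq vC) node_const1 //.
by apply: le_lt_trans (tz i); apply: (uabsXB_le vC).
Qed.

(** Along the exponents [alpha + lam * k] these powers are constant; this is what makes the arc
    means converge. *)
Lemma residue_const_fixed i alpha k :
  z i ^+ (p ^ (alpha + lam * k)) = z i ^+ (p ^ alpha).
Proof.
elim: k => [|k IH]; first by rewrite muln0 addn0.
by rewrite mulnS addnCA expnD exprM zlam.
Qed.

(** Pole by pole: an outer weight has size [abs (t c) ^- (p ^ n)]; in hole [i] the weight differs
    from its limit by a unit times the difference of the [p ^ n]-th powers of [t c] and [z i], which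
    share a residue class. *)
Lemma vanishing_arc_mean s alpha : well_placed s ->
  vanishing abs (fun k => arc_mean a b (pole_sum s) (alpha + lam * k) -
    \sum_i 1 / (1 - z i ^+ (p ^ alpha)) * \sum_(wc <- s | hole i wc) wc.1).
Proof.
move=> sP; pose lim (wc : C * C) := \sum_(i | hole i wc) 1 / (1 - z i ^+ (p ^ alpha)) * wc.1.
have limE : \sum_i 1 / (1 - z i ^+ (p ^ alpha)) * \sum_(wc <- s | hole i wc) wc.1 =
    \sum_(wc <- s) lim wc.
  under eq_bigr do rewrite mulr_sumr.
  by rewrite (exchange_big_dep xpredT).
have kn k : (k <= alpha + lam * k)%N by rewrite (leq_trans (leq_pmull k lam0)) // leq_addl.
apply: (vanishing_le (N0 := 0) _ (@vanishing_sum R C abs vC _ s (fun wc k =>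
  wc.1 * (1 * t wc.2 ^+ 0 / (1 - t wc.2 ^+ (p ^ (alpha + lam * k)))) - lim wc) _)) => [k _|wc ws].
  by rewrite (arc_mean_pole_sum sP) limE sumrB.
have [ho|[i hi]] := sP wc ws.
  have t1 : 1 < abs (t wc.2) by rewrite abs_t ltr_pdivlMr ?mul1r.
  have iT1 : abs (t wc.2)^-1 < 1 by rewrite (uabsV vC) invf_lt1 // (lt_trans ltr01).
  apply: (vanishing_le (N0 := 0) _ (vanishing_geom vC wc.1 iT1)) => k _.
  rewrite /lim big_pred0 ?subr0; last by move=> i; apply/negP => /hole_not_outer; rewrite ho.
  rewrite expr0 !mul1r !(uabsM vC) ler_wpM2l ?uabs_ge0 //.
  set n := (alpha + lam * k)%N.
  have pn : (n < p ^ n)%N by apply: ltn_expl; apply: prime_gt1.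
  have tn : abs 1 < abs (- t wc.2 ^+ (p ^ n)).
    rewrite (uabs1 vC) (uabsN vC) (uabsX vC) exprn_egt1 // gtn_eqF //.
    exact: leq_ltn_trans pn.
  rewrite (uabsV vC) addrC (uabsD_eq vC tn) (uabsN vC) !(uabsX vC).
  rewrite -exprVn -(uabsV vC) ler_wiXn2l ?uabs_ge0 //; first exact: ltW.
  exact: leq_trans (kn k) (ltnW pn).
have t1 : abs (t wc.2) <= 1 by rewrite abs_t ler_pdivrMr // mul1r (hole_inner hi).
have txc : abs (t wc.2 - t (x i)) < 1.
  have -> : t wc.2 - t (x i) = (wc.2 - x i) / (b - a) by field.
  rewrite (uabsM vC) (uabsV vC) ltr_pdivrMr // mul1r.
  exact: lt_le_trans hi (yrad i).
have tcz : abs (t wc.2 - z i) < 1 by apply: (uabs_tr_lt vC txc).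
have limw : lim wc = wc.1 * (1 / (1 - z i ^+ (p ^ alpha))).
  rewrite /lim (big_pred1 i) 1?mulrC // => j /=.
  by apply/idP/eqP => [hj|->//]; apply: hole_uniq hj hi.
have lim0 : vanishing abs (fun k => wc.1 * (t wc.2 ^+ (p ^ (alpha + lam * k)) - z i ^+ (p ^ (alpha + lam * k)))).
  move=> e e0; have [w0|w0] := eqVneq wc.1 0.
    by exists 0%N => k _; rewrite w0 mul0r (uabs0 vC) ltW.
  have vw : 0 < abs wc.1 by rewrite (uabs_gt0 vC).
  have [N HN] := uabs_expn_lim vC p_prime vp t1 (z1 i) tcz (divr_gt0 e0 vw).
  exists N => k Nk; rewrite (uabsM vC) mulrC -ler_pdivlMr // ltW // HN //.
  exact: leq_trans Nk (kn k).
apply: (vanishing_le (N0 := 0) _ lim0) => k _; rewrite limw expr0.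
have c1 := residue_const1 i alpha; rewrite -(residue_const_fixed i alpha k) in c1 *.
set n := (alpha + lam * k)%N in c1 *.
have d1 : abs (1 - t wc.2 ^+ (p ^ n)) = 1.
  have -> : 1 - t wc.2 ^+ (p ^ n) = (1 - z i ^+ (p ^ n)) - (t wc.2 ^+ (p ^ n) - z i ^+ (p ^ n)) by ring.
  rewrite (uabsD_eq vC) c1 // (uabsN vC).
  by apply: le_lt_trans tcz; apply: (uabsXB_le vC).
set Z := z i ^+ _ in c1 d1 *; set T := t wc.2 ^+ _ in d1 *.
have Z0 : 1 - Z != 0 by rewrite -(uabs_gt0 vC) c1.
have T0 : 1 - T != 0 by rewrite -(uabs_gt0 vC) d1.
have -> : wc.1 * (1 * 1 / (1 - T)) - wc.1 * (1 / (1 - Z)) =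
  wc.1 * (T - Z) / ((1 - T) * (1 - Z)) by field; rewrite T0 Z0.
by rewrite (uabsM vC (wc.1 * _)) (uabsV vC) (uabsM vC (1 - T)) c1 d1 mulr1 invr1 mulr1.
Qed.

Lemma node_perforated n (w : C) : w ^+ (p ^ n) = 1 -> perforated (a + (b - a) * w).
Proof.
move=> wn; have aw : abs w = 1.
  apply: (pexpIrn (n := p ^ n)); rewrite ?nnegrE ?uabs_ge0 ?ler01 ?expn_gt0 ?prime_gt0 //.
  by rewrite -(uabsX vC) wn (uabs1 vC) expr1n.
split; first by rewrite addrAC subrr add0r (uabsM vC) aw mulr1.
move=> i; have -> : a + (b - a) * w - x i = (b - a) * (w - t (x i)) by field.
apply: le_trans (yrad i) _; rewrite (uabsM vC) ler_peMr ?uabs_ge0 //.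
rewrite -(node_const1 i n) -wn; apply: (uabsXB_le vC) => //.
by rewrite aw.
Qed.

Definition opp_poles (s : seq (C * C)) := [seq (- wc.1, wc.2) | wc <- s].

Lemma pole_sum_sub s s' c : pole_sum (s ++ opp_poles s') c = pole_sum s c - pole_sum s' c.
Proof.
rewrite /pole_sum big_cat big_map -sumrN; congr (_ + _).
by apply: eq_bigr => wc _; rewrite mulNr.
Qed.

Lemma well_placed_sub s s' : well_placed s -> well_placed s' -> well_placed (s ++ opp_poles s').
Proof.
move=> sP s'P wc; rewrite mem_cat => /orP[|/mapP[wc' ws' ->]]; first exact: sP.
exact: s'P wc' ws'.
Qed.

(** A direct estimate would lose [p^-n]. For the given [n] a second list [s'] is taken so close to
    [f] that even this loss is at most [e']; the remaining [s' - s] is a pole sum, bounded uniformly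
    by [arc_weight_le]. *)
Lemma arc_mean_close f s (e : R) n : well_placed s -> 0 < e ->
  (forall c, perforated c -> abs (f c - pole_sum s c) <= e) ->
  (forall e', 0 < e' -> exists2 s', well_placed s' &
     forall c, perforated c -> abs (f c - pole_sum s' c) <= e') ->
  abs (arc_mean a b f n - arc_mean a b (pole_sum s) n) <= rad * e.
Proof.
move=> sP e0 fs fa; have pn : (0 < p ^ n)%N by rewrite expn_gt0 prime_gt0.
have [w wn] := Cp_prim_root C p_prime pn.
have node i : perforated (a + (b - a) * w ^+ i).
  by apply: (@node_perforated n); rewrite exprAC (prim_expr_order wn) expr1n.
have N0 : 0 < abs (p ^ n)%:R by rewrite (uabs_gt0 vC) Cp_nat_neq0.
apply: (uabs_limit_le vC) => e' e'0.
pose d := Num.min e (e' * abs (p ^ n)%:R / rad).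
have d0 : 0 < d by rewrite lt_min e0 !divr_gt0 // mulr_gt0.
have [s' s'P fs'] := fa d d0.
exists (arc_mean a b (pole_sum (s' ++ opp_poles s)) n).
  have ssP := well_placed_sub s'P sP; rewrite (arc_mean_pole_sum ssP).
  apply: (arc_weight_le ssP (ltW e0)) => c cp; rewrite pole_sum_sub.
  apply: (uabs_tr_le vC (z := f c)); last exact: fs.
  by rewrite (uabs_sub vC); apply: le_trans (fs' c cp) _; rewrite ge_min lexx.
have -> : arc_mean a b f n - arc_mean a b (pole_sum s) n -
    arc_mean a b (pole_sum (s' ++ opp_poles s)) n =
    arc_mean a b (fun c => f c - pole_sum s' c) n.
  rewrite !(arc_mean_nodes _ _ _ wn) -!mulrBr -!sumrB; congr (_ * _).
  by apply: eq_bigr => i _; rewrite pole_sum_sub; ring.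
rewrite (arc_mean_nodes _ _ _ wn) (uabsM vC) (uabsV vC) mulrC ler_pdivrMr //.
apply: (uabs_sum_le vC) => [|i _]; first by rewrite mulr_ge0 // ltW.
rewrite (uabsM vC) expr1 (uabsM vC) (uabsX vC) (prim_root_abs wn) expr1n mulr1.
rewrite mulrC -ler_pdivlMr //; apply: le_trans (fs' _ (node i)) _.
by rewrite ge_min lexx orbT.
Qed.

Theorem circle_integral (alpha : nat) (f : C -> C) (J : 'I_M -> C) :
  (forall e, 0 < e -> exists s, [/\ well_placed s,
     forall c, perforated c -> abs (f c - pole_sum s c) <= e &
     forall i, abs (\sum_(wc <- s | hole i wc) wc.1 - J i) <= e]) ->
  is_arc_integral a b (Phi_ alpha%:Z) f
    (\sum_i 1 / (1 - z i ^+ (p ^ alpha)) * J i).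
Proof.
move=> fa e e0; pose d := Num.min (e / 2) (e / 2 / rad).
have d0 : 0 < d by rewrite lt_min !divr_gt0.
have [s [sP fs sJ]] := fa d d0.
(* The path has slope [lam] and does not depend on [e]; only [K] does. *)
have [phi [_ phiE]] := Phi_path_exists alpha%:Z 0 lam0.
exists phi; split; first by exists lam.
have e2 : 0 < e / 2 by rewrite divr_gt0.
have [K HK] := vanishing_arc_mean alpha sP e2.
exists K => k ks Kk; have -> : phi k = (alpha + lam * k)%N.
  by have := phiE k ks => -[].
apply: (@le_lt_trans _ _ (e / 2)); last by rewrite ltr_pdivrMr // ltr_pMr // ltr1n.
apply: (uabs_tr_le vC (z := arc_mean a b (pole_sum s) (alpha + lam * k))).
  apply: le_trans (arc_mean_close _ sP d0 fs _) _.
    move=> e' e'0; have [s' [s'P fs' _]] := fa e' e'0.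
    by exists s'.
  by rewrite mulrC -ler_pdivlMr // ge_min lexx orbT.
apply: (uabs_tr_le vC (HK k (ltnW Kk))).
rewrite -sumrB; apply: (uabs_sum_le vC) => [|i _]; first exact: ltW.
rewrite -mulrBr (uabsM vC) mul1r (uabsV vC) residue_const1 invr1 mul1r.
by apply: le_trans (sJ i) _; rewrite ge_min lexx.
Qed.

End BigCircle.

Section Residues.
Variables (R : realType) (p : nat) (C : Cp_tower R p).
Hypothesis p_prime : prime p.

Local Notation abs := (@Cp_abs R p C).
Let vC := Cp_absP C.

(** The moment [l = 0] of the difference of two approximants bounds the difference of their residue
    sums, so these are Cauchy in each hole. *)
Lemma residues_exist (a b : C) (M : nat) (x y : 'I_M -> C) (f : C -> C) :
  (forall i, abs (x i - a) <= abs (b - a)) -> (forall i, y i != 0) ->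
  (forall i, abs (y i) <= abs (b - a)) ->
  (forall i j, i != j -> abs (y i) < abs (x i - x j)) ->
  (forall e, 0 < e -> exists2 s, well_placed a b x y s &
     forall c, perforated a b x y c -> abs (f c - pole_sum s c) <= e) ->
  exists J : 'I_M -> C, forall e, 0 < e -> exists s, [/\ well_placed a b x y s,
     forall c, perforated a b x y c -> abs (f c - pole_sum s c) <= e &
     forall i, abs (\sum_(wc <- s | hole x y i wc) wc.1 - J i) <= e].
Proof.
move=> xa y0 yrad sep fa.
have inv0 k : 0 < (k.+1%:R : R)^-1 by rewrite invr_gt0 ltr0n.
have /choice [s sP] k : exists s, well_placed a b x y s /\
    forall c, perforated a b x y c -> abs (f c - pole_sum s c) <= k.+1%:R^-1.
  by have [s] := fa _ (inv0 k); exists s.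
pose res i k := \sum_(wc <- s k | hole x y i wc) wc.1.
have invS k l : (k <= l)%N -> (l.+1%:R : R)^-1 <= k.+1%:R^-1.
  by move=> kl; rewrite lef_pV2 ?posrE ?ltr0n // ler_nat ltnS.
have resB i N k l : (N <= k)%N -> (N <= l)%N ->
    abs (res i k - res i l) <= abs (y i) * N.+1%:R^-1.
  move=> Nk Nl; have [wk fk] := sP k; have [wl fl] := sP l.
  have w := well_placed_sub wk wl.
  have -> : res i k - res i l = \sum_(wc <- s k ++ opp_poles (s l) | hole x y i wc)
      wc.1 * (wc.2 - x i) ^+ 0.
    by rewrite big_cat big_map /res -sumrN; congr (_ + _); apply: eq_bigr => wc _;
      rewrite expr0 mulr1.
  rewrite -[X in X * _]expr1; apply: (hole_moments p_prime) => // [wc ws|c ci].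
    by have := hole_dichotomy xa yrad sep i w ws.
  have cp := circle_perforated xa yrad sep ci.
  rewrite pole_sum_sub; apply: (uabs_tr_le vC (z := f c)).
    by rewrite (uabs_sub vC); apply: le_trans (fk c cp) (invS _ _ Nk).
  by apply: le_trans (fl c cp) (invS _ _ Nl).
have small (K e : R) : 0 < e -> 0 <= K -> exists N, K * (N.+1%:R)^-1 < e.
  move=> e0 K0; exists (Num.bound (K / e)).
  rewrite ltr_pdivrMr ?ltr0n // mulrC -ltr_pdivrMr //.
  apply: lt_le_trans (archi_boundP _) _; first by rewrite divr_ge0 // ltW.
  by rewrite ler_nat.
have [_ _ complC] := Cp_completion C.
have /choice [J JP] i : exists l, forall e, 0 < e ->
    exists N, forall n, (N <= n)%N -> abs (res i n - l) < e.
  apply: complC => e e0; have [N HN] := small _ _ e0 (uabs_ge0 vC (y i)).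
  by exists N => m n Nm Nn; apply: le_lt_trans (resB i N m n Nm Nn) HN.
exists J => e e0.
have /choice [N NP] i := JP i e e0.
have [N0 HN0] := small 1 e e0 ler01.
pose k := (N0 + \sum_i N i)%N.
have [wk fk] := sP k; exists (s k); split=> // [c cp|i].
  apply: le_trans (fk c cp) _; apply: le_trans (ltW HN0); rewrite mul1r.
  by apply: invS; apply: leq_addr.
apply: ltW; apply: (NP i); rewrite /k (bigD1 i) //= addnCA leq_addr //.
Qed.

Lemma krasner_pole_approx (a : C) (rad : R) (M : nat) (x : 'I_M -> C) (rho : 'I_M -> R)
    (f : C -> C) : 0 < rad -> (forall i, 0 < rho i) ->
  let D := closed_disc a rad `\` \bigcup_i open_disc (x i) (rho i) in
  krasner_analytic D f -> pole_approx abs D f.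
Proof.
move=> rad0 rho0 D [h [hD hf]].
have DB c : D c -> abs c <= Num.max rad (abs a).
  move=> [/= cr _]; rewrite -[c](subrK a); apply: (uabsD_le vC).
    by apply: le_trans cr _; rewrite le_max lexx.
  by rewrite le_max lexx orbT.
(* A point beyond the big disc has distance more than [rad] from [D], and a point of a removed disc
   has distance at least [rho i]. *)
have Dsep c : ~ D c -> exists2 d, 0 < d & forall u, D u -> d <= abs (u - c).
  move=> Dc; have [ca|ca] := leP (abs (c - a)) rad; last first.
    exists rad => // u [/= ua _]; have -> : u - c = (u - a) - (c - a) by ring.
    rewrite (uabs_sub vC) (uabsD_eq vC) ?(uabsN vC) ?(le_lt_trans ua) // ltW //.
  have [i ci] : exists i, abs (c - x i) < rho i.
    apply: contrapT => nc; apply: Dc; split=> // -[i _ ci].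
    by apply: nc; exists i.
  exists (rho i) => // u [_ /= nu]; have ui : rho i <= abs (u - x i).
    by rewrite leNgt; apply/negP => ui; apply: nu; exists i.
  have -> : u - c = (u - x i) - (c - x i) by ring.
  by rewrite (uabsD_eq vC) // (uabsN vC); apply: lt_le_trans ci ui.
have p0 : (p%:R : C) != 0 by rewrite Cp_nat_neq0 ?prime_gt0.
apply: (pole_approx_lim vC) => e e0; have [N HN] := hf e e0.
exists (rf_eval (h N)); last by move=> c Dc; apply: ltW; apply: HN.
have [s sE] := completion_split vC (Cp_completion C) (rf_den_neq0 (h N)).
have := pole_approx_frac vC DB Dsep p0 (Cp_p_lt1 C p_prime)
   ((lead_coef (rf_den (h N)))^-1 *: rf_num (h N)) (s := s).
move=> H; apply: (eq_pole_approx vC) (H _) => [c _|c cs].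
  rewrite /rf_eval [in RHS]sE !hornerZ invfM mulrA; congr (_ / _).
  by rewrite mulrC.
apply: (hD N); rewrite /rf_pole sE rootZ ?lead_coef_eq0 ?rf_den_neq0 //.
by rewrite root_prod_XsubC.
Qed.

End Residues.

Theorem theorem6p3
  (R : realType) (p : nat) (p_prime : prime p) (p_odd : odd p)
  (C : Cp_tower R p)
  (a : C) (rad : R) (rad_gt0 : 0 < rad)
  (M : nat) (x : 'I_M -> C) (rho : 'I_M -> R)
  (rho_bounds : forall i, 0 < rho i < rad)
  (r : 'I_M -> R) (r_bounds : forall i, rho i <= r i < rad)
  (b : C) (b_circle : circle a rad b)
  (b_dist : forall i, Cp_abs (b - x i) = rad)
  (bb : 'I_M -> C) (bb_circle : forall i, circle (x i) (r i) (bb i))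
  (discs_disjoint : trivIset setT (fun i => closed_disc (x i) (r i)))
  (alpha : nat) (f : C -> C)
  (f_analytic :
     krasner_analytic
       (closed_disc a rad `\` \bigcup_i open_disc (x i) (rho i)) f) :
  exists (I : C) (J : 'I_M -> C),
    [/\ is_arc_integral a b (Phi_ alpha%:Z) f I,
        forall i, is_arc_integral (x i) (bb i) (Phi_ alpha%:Z) f (J i) &
        I = \sum_(i < M)
              1 / (1 - teichmuller ((a - x i) / (a - b)) ^+ (p ^ alpha)) * J i].
Proof.
have vC := Cp_absP C; pose y i := bb i - x i.
have radE : Cp_abs (b - a) = rad by [].
have yr i : Cp_abs (y i) = r i by exact: bb_circle.
have rho0 i : 0 < rho i by case/andP: (rho_bounds i).
have rhor i : rho i <= r i by case/andP: (r_bounds i).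
have rrad i : r i < rad by case/andP: (r_bounds i).
have r0 i : 0 < r i by apply: lt_le_trans (rho0 i) (rhor i).
have ab : b - a != 0 by rewrite -(uabs_gt0 vC) radE.
have xa i : Cp_abs (x i - a) <= Cp_abs (b - a).
  by apply: (uabs_tr_le vC (z := b)); rewrite // (uabs_sub vC) b_dist radE.
have y0 i : y i != 0 by rewrite -(uabs_gt0 vC) yr.
have yrad i : Cp_abs (y i) <= Cp_abs (b - a) by rewrite yr radE ltW.
(* Otherwise [x j] would lie in both closed discs. *)
have sep i j : i != j -> Cp_abs (y i) < Cp_abs (x i - x j).
  move=> /eqP ij; rewrite yr ltNge; apply/negP => h; apply: ij.
  apply: discs_disjoint => //; exists (x j); split; rewrite /closed_disc /=.
    by rewrite (uabs_sub vC).
  by rewrite subrr (uabs0 vC) ltW.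
have fa e : 0 < e -> exists2 s, well_placed a b x y s &
    forall c, perforated a b x y c -> Cp_abs (f c - pole_sum s c) <= e.
  move=> e0; have [s sD fs] := krasner_pole_approx p_prime rad_gt0 rho0 f_analytic e0.
  exists s => [wc ws|c [ca cx]].
    have [ca|ca] := leP (Cp_abs (wc.2 - a)) rad; last by left; rewrite /outer radE.
    right; apply: contrapT => nh; apply: (sD wc ws); split=> // -[i _ ci].
    by apply: nh; exists i; rewrite /hole yr; apply: lt_le_trans ci (rhor i).
  apply: fs; split=> [|[i _ ci]]; first by rewrite /closed_disc /= -radE.
  by have := cx i; rewrite yr leNgt (lt_le_trans ci (rhor i)).
have [J JP] := residues_exist p_prime xa y0 yrad sep fa.
pose t i := (a - x i) / (a - b).
have tE i : t i = (x i - a) / (b - a).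
  by rewrite /t -opprB -[a - b]opprB invrN mulrNN.
have t1 i : Cp_abs (t i) <= 1.
  by rewrite tE (uabsM vC) (uabsV vC) ler_pdivrMr ?mul1r // radE.
have /choice [l lP] i : exists l, (0 < l)%N /\ teichmuller (t i) ^+ (p ^ l) = teichmuller (t i).
  by have [_ [l l0 h]] := teichmullerP p_prime (t1 i); exists l.
(* A multiple of every [l i], so that one exponent fixes all the representatives. *)
pose lam := (\prod_i l i)%N.
have lam0 : (0 < lam)%N by apply: prodn_gt0 => i; case: (lP i).
have zlam i : teichmuller (t i) ^+ (p ^ lam) = teichmuller (t i).
  rewrite /lam (bigD1 i) //= expnM; case: (lP i) => _ h.
  by elim: (\prod_(_ | _) _)%N => [|n IH]; rewrite ?expn0 ?expr1 // expnS exprM h.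
have tz i : Cp_abs ((x i - a) / (b - a) - teichmuller (t i)) < 1.
  by rewrite -tE; have [] := teichmullerP p_prime (t1 i).
exists (\sum_(i < M) 1 / (1 - teichmuller (t i) ^+ (p ^ alpha)) * J i), J.
split=> // [|i].
  apply: (circle_integral p_prime p_odd ab lam0 xa _ y0 yrad sep tz zlam) => // i.
  by rewrite b_dist radE.
(* The arc integral around the hole [i] is the case of a single hole centred at
   the centre of the circle, with residue constant [1 / (1 - 0) = 1]. *)
pose x' (_ : 'I_1) := x i; pose y' (_ : 'I_1) := y i.
have := @circle_integral R p C p_prime p_odd (x i) (bb i) 1 x' y' (fun=> 0) 1
  (y0 i) isT _ _ _ _ _ _ _ alpha f (fun=> J i).
have z0 : (0 : C) ^+ (p ^ alpha) = 0 by rewrite expr0n gtn_eqF // expn_gt0 prime_gt0.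
rewrite big_ord1 z0 subr0 divr1 mul1r; apply.
- by move=> k; rewrite /x' subrr (uabs0 vC) uabs_ge0.
- by [].
- by move=> k; apply: y0.
- by move=> k; apply: lexx.
- by move=> j k; rewrite !ord1.
- by move=> k; rewrite /x' subrr mul0r subr0 (uabs0 vC).
- by move=> k; rewrite expr0n expn1 gtn_eqF ?prime_gt0.
(* For this single hole [perforated] shrinks to the circle itself, and the poles in other holes
   count as outer. *)
move=> e e0; have [s [sP fs sJ]] := JP e e0; exists s; split=> [wc ws|c [cl cg]|k].
- case: (hole_dichotomy xa yrad sep i sP ws) => h; last by left.
  by right; exists ord0.
- apply: fs; apply: (circle_perforated xa yrad sep (i := i)).
  by apply/eqP; rewrite eq_le cl (cg ord0).
- exact: sJ.
Qed.
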